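(* For every real number $q\ge 2$, $$\|(Z-\mathbb{E}[Z])_+\|_q \le \sqrt{\Bigl(1-\frac1q\Bigr)2\kappa_q\, q\,\|V^+\|_{q/2}} \le \sqrt{2\kappa q\,\|V^+\|_{q/2}} = \sqrt{2\kappa q}\,\bigl\|\sqrt{V^+}\bigr\|_q$$ and $$\|(Z-\mathbb{E}[Z])_-\|_q \le \sqrt{\Bigl(1-\frac1q\Bigr)2\kappa_q\, q\,\|V^-\|_{q/2}} \le \sqrt{2\kappa q\,\|V^-\|_{q/2}} = \sqrt{2\kappa q}\,\bigl\|\sqrt{V^-}\bigr\|_q .$$
   Context: Let $X_1,\dots,X_n$ be independent random variables taking values in a measurable space $\mathcal{X}$, let $F:\mathcal{X}^n\to\mathbb{R}$ be measurable, and let $Z=F(X_1,\dots,X_n)$, assumed integrable so that $\mathbb{E}[Z]$ is defined. Let $(X_1',\dots,X_n')$ be an independent copy of $(X_1,\dots,X_n)$ and put $Z_i'=F(X_1,\dots,X_{i-1},X_i',X_{i+1},\dots,X_n)$. Write $x_+=\max(x,0)$, $x_-=\max(-x,0)$, and $$V^+=\mathbb{E}\Bigl[\sum_{i=1}^n (Z-Z_i')_+^2\,\Big|\,X_1,\dots,X_n\Bigr],\qquad V^-=\mathbb{E}\Bigl[\sum_{i=1}^n (Z-Z_i')_-^2\,\Big|\,X_1,\dots,X_n\Bigr].$$ For $q>0$, $\|Y\|_q=(\mathbb{E}|Y|^q)^{1/q}$ (possibly $+\infty$). For real $q\ge2$, $\kappa_q=\frac12\bigl(1-(1-\frac1q)^{q/2}\bigr)^{-1}$,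 and $\kappa=\frac{\sqrt e}{2(\sqrt e-1)}<1.271$. *)

(* Defs.v *)
From HB Require Import structures.
From mathcomp Require Export all_boot all_order all_algebra.
From mathcomp Require Export all_classical all_reals all_analysis.
From mathcomp Require Export measurable_realfun.

Set Implicit Arguments.
Unset Strict Implicit.
Unset Printing Implicit Defensive.
Import Order.TTheory GRing.Theory Num.Theory.

Local Open Scope classical_set_scope.
Local Open Scope ring_scope.

Definition mutually_independent {d d' : measure_display}
    {Omega : measurableType d} {T : measurableType d'} {R : realType}
    (P : probability Omega R) {n : nat} (X : 'I_n -> Omega -> T) : Prop :=
  forall (J : {set 'I_n}) (B : 'I_n -> set T),
    (forall i, i \in J -> measurable (B i)) ->
    P (\bigcap_(i in [set` J]) (X i @^-1` B i)) =
    (\prod_(i in J) P (X i @^-1` B i))%E.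

Definition same_law {d d' : measure_display}
    {Omega : measurableType d} {S : measurableType d'} {R : realType}
    (P : probability Omega R) (Y Y' : Omega -> S) : Prop :=
  forall B : set S, measurable B -> P (Y' @^-1` B) = P (Y @^-1` B).

Definition independent2 {d d' : measure_display}
    {Omega : measurableType d} {S : measurableType d'} {R : realType}
    (P : probability Omega R) (Y Y' : Omega -> S) : Prop :=
  forall A B : set S, measurable A -> measurable B ->
    P ((Y @^-1` A) `&` (Y' @^-1` B)) = (P (Y @^-1` A) * P (Y' @^-1` B))%E.

Definition independent_copy {d d' : measure_display}
    {Omega : measurableType d} {S : measurableType d'} {R : realType}
    (P : probability Omega R) (Y Y' : Omega -> S) : Prop :=
  same_law P Y Y' /\ independent2 P Y Y'.

(* The product sigma-algebra on [n.-tuple T] is the library's one, generated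
   by the coordinate maps. *)
Definition joint {Omega T : Type} {n : nat} (X : 'I_n -> Omega -> T)
    (w : Omega) : n.-tuple T :=
  [tuple X i w | i < n].

(* (X_1, .., X_{i-1}, X'_i, X_{i+1}, .., X_n) *)
Definition joint_resample {Omega T : Type} {n : nat}
    (X X' : 'I_n -> Omega -> T) (i : 'I_n) (w : Omega) : n.-tuple T :=
  [tuple (if j == i then X' j w else X j w) | j < n].

Definition sigma_of {d' : measure_display} {Omega : Type}
    {S : measurableType d'} (Y : Omega -> S) : set_system Omega :=
  preimage_set_system setT Y (@measurable d' S).

(* [V] is a version of the conditional expectation, given the sub-sigma-algebra
   [G], of the nonnegative random variable [Y].  As [Y] need not be integrable,
   [V] takes values in [0, +oo]; it is determined up to a P-null set. *)
Definition is_nonneg_cond_expectation {d : measure_display}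
    {Omega : measurableType d} {R : realType} (P : probability Omega R)
    (G : set_system Omega) (Y V : Omega -> \bar R) : Prop :=
  [/\ (forall w, (0 <= V w)%E),
      (forall B : set (\bar R), measurable B -> G (V @^-1` B)) &
      (forall A : set Omega, G A ->
         \int[P]_(w in A) V w = \int[P]_(w in A) Y w)%E].

Definition pos_part {R : realType} (x : R) : R := Num.max x 0.
Definition neg_part {R : realType} (x : R) : R := Num.max (- x) 0.

Definition kappa_ {R : realType} (q : R) : R :=
  2^-1 * (1 - (1 - q^-1) `^ (q / 2))^-1.

Definition kappa {R : realType} : R :=
  Num.sqrt (expR 1) / (2 * (Num.sqrt (expR 1) - 1)).

(* Main.v *)
Require Import Defs.
From HB Require Import structures.
From mathcomp Require Import all_boot all_order all_algebra.
From mathcomp Require Import all_classical all_reals all_analysis.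
From mathcomp Require Import measurable_realfun.
From mathcomp Require Import ring lra.

Set Implicit Arguments.
Unset Strict Implicit.
Unset Printing Implicit Defensive.
Import Order.TTheory GRing.Theory Num.Theory.

Local Open Scope classical_set_scope.
Local Open Scope ring_scope.

(** The upper bound controls the moments of a truncated excess
    f = max (min (Z - E Z) M) eps one after the other.  A truncation of this
    kind is a nondecreasing 1-Lipschitz function of F, so its drops when one
    coordinate is resampled are at most those of F.

    The engine is [moment_inequality]: for real s >= 2,

      E f^s <= (E f^{s-1})^{s/(s-1)} + (s - 1) E [V f^{s-2}],   V = V^+.

    It comes from the power entropy E Y^{1+r} - (E Y)^{1+r} of Y = f^{s-1},
    with r = 1/(s-1) in ]0,1].  That entropy is bounded by the sum over i of
    its one-coordinate versions ([entropy_tensorization]), because the Bregman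
    divergence of x^{1+r} is jointly convex ([bregman_powR]).  A one-coordinate
    entropy is at most a covariance of Y and Y^r, which symmetrization turns
    into a mean of (Y - Y')_+ (Y^r - Y'^r)_+ ([entropy_le_covariance]).  Here
    Y^r = f, and a tangent line bounds Y - Y' by (s - 1) f^{s-2} (f - f').

    Let c be (slightly more than) the norm of V in L^{q/2}.  Young's inequality
    gives E [V f^{s-2}] <= c (E f^s)^{1-2/s} for all s <= q
    ([integral_weighted_le]), so the inequality above becomes a recursion on
    the norms of f.  The number kappa_s is the one for which
    2 kappa_s (s - 1) c reproduces itself in this recursion as a bound on
    ||f||_s^2 ([moment_recursion]); since kappa_s increases with s, unit steps
    from s - 1 to s propagate the bound from [2, 3[ up to q
    ([moment_induction]).  The interval [2, 3[ is reached from
    E f^2 <= c, which is the Efron-Stein inequality, itself the case s = 2 of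
    the same moment inequality ([clip_variance]).

    The truncation keeps f between two positive constants, so all moments are
    finite, the recursion can be solved for E f^s, and negative powers of f
    make sense.  It is removed by monotone convergence ([upper_moment_le]).
    Replacing F by -F exchanges the two parts of Z - E Z and turns V^+ into
    V^-; the passage from kappa_q to kappa uses that kappa is the limit of the
    increasing function kappa_q ([kappa_le_kappa]). *)

(** * Convexity inequalities for real powers *)

Lemma powR_1D (R : realType) (x r : R) : 0 <= x -> 0 <= r ->
  x `^ (1 + r) = x * x `^ r.
Proof.
move=> x0 r0; have p0 : 0 < 1 + r by rewrite ltr_pwDl.
by rewrite -(mulr_powRB1 x0 p0) [1 + r]addrC addrK.
Qed.

(** Young's inequality for x^t and 1 with weights t and 1 - t: the graph of
    x^t lies below its tangent at 1. *)
Lemma powR_concave1 (R : realType) (t x : R) : 0 <= t -> t <= 1 -> 0 <= x ->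
  x `^ t <= 1 - t + t * x.
Proof.
rewrite le_eqVlt => /predU1P[<- _ _|t0]; first by rewrite powRr0; lra.
rewrite le_eqVlt => /predU1P[-> x0|t1 x0]; first by rewrite powRr1//; lra.
have t1' : 0 < 1 - t by lra.
have := @conjugate_powR R (x `^ t) 1 t^-1 (1 - t)^-1 (powR_ge0 _ _) ler01.
rewrite !invr_gt0 !invrK mulr1 powR1 -powRrM divff ?gt_eqF// powRr1//.
move=> /(_ t0 t1'); have -> : t + (1 - t) = 1 by lra.
by move=> /(_ erefl); lra.
Qed.

Lemma powR_convex1 (R : realType) (m x : R) : 1 <= m -> 0 <= x ->
  1 + m * (x - 1) <= x `^ m.
Proof.
move=> m1 x0; have m0 : 0 < m by exact: lt_le_trans m1.
have := @powR_concave1 R m^-1 (x `^ m).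
rewrite invr_ge0 (ltW m0) invf_le1// m1 powR_ge0 -powRrM divff ?gt_eqF// powRr1//.
move=> /(_ isT isT isT) h.
have : m * x <= m * (1 - m^-1 + m^-1 * x `^ m) by rewrite ler_pM2l.
by rewrite mulrDr mulrBr mulrA divff ?gt_eqF// mul1r; lra.
Qed.

Lemma powR_tangent (R : realType) (m x y : R) : 1 <= m -> 0 <= x -> 0 < y ->
  y `^ m + m * y `^ (m - 1) * (x - y) <= x `^ m.
Proof.
move=> m1 x0 y0.
have := @powR_convex1 R m (x / y) m1 (divr_ge0 x0 (ltW y0)).
have -> : x `^ m = (x / y) `^ m * y `^ m.
  by rewrite -powRM ?divr_ge0 ?(ltW y0)// divfK ?gt_eqF.
have -> : y `^ m = y `^ (m - 1) * y.
  by rewrite mulrC mulr_powRB1 ?(ltW y0)//; lra.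
move=> h; have := @ler_pM2r _ (y `^ (m - 1) * y).
rewrite mulr_gt0 ?powR_gt0// => /(_ isT) hh.
move: h; rewrite -hh.
have -> : (1 + m * (x / y - 1)) * (y `^ (m - 1) * y) =
  y `^ (m - 1) * y + m * y `^ (m - 1) * (x / y * y - y) by ring.
by rewrite divfK ?gt_eqF.
Qed.

Lemma powR_jensen (R : realType) (m t x y : R) : 1 <= m -> 0 <= t <= 1 ->
  0 < x -> 0 < y ->
  (t * x + (1 - t) * y) `^ m <= t * x `^ m + (1 - t) * y `^ m.
Proof.
move=> m1 /andP[t0 t1] x0 y0; set z := t * x + (1 - t) * y.
have z0 : 0 < z by rewrite /z; nra.
have hx := powR_tangent m1 (ltW x0) z0.
have hy := powR_tangent m1 (ltW y0) z0.
have hz : t * (x - z) + (1 - t) * (y - z) = 0 by rewrite /z; ring.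
set K := m * z `^ (m - 1) in hx hy.
have h0 : t * (K * (x - z)) + (1 - t) * (K * (y - z)) = 0.
  by rewrite -[RHS](mulr0 K) -hz; ring.
nra.
Qed.

(** Jensen for (u + v - 1) / v, which for 1 <= v is the mean of u and 1 with
    weights 1/v and 1 - 1/v.  With [mixed_difference_slope_le] it gives the sign
    of the derivative in v used in [mixed_difference_le]. *)
Lemma mixed_difference_slope_ge (R : realType) (m u v : R) : 1 <= m -> 0 < u -> 1 <= v ->
  (u + v - 1) `^ m <= v `^ m - (1 - u `^ m) * v `^ (m - 1).
Proof.
move=> m1 u0 v1; have v0 : 0 < v by lra.
have := @powR_jensen R m v^-1 u 1 m1 _ u0 ltr01.
rewrite invr_ge0 (ltW v0) invf_le1// v1 => /(_ isT); rewrite powR1.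
have -> : v^-1 * u + (1 - v^-1) * 1 = (u + v - 1) / v.
  by field; rewrite gt_eqF.
move=> h.
have -> : v `^ m - (1 - u `^ m) * v `^ (m - 1)
   = (v^-1 * u `^ m + (1 - v^-1)) * v `^ m.
  have -> : v `^ m = v * v `^ (m - 1) by rewrite mulr_powRB1//; lra.
  by field; rewrite gt_eqF.
have -> : (u + v - 1) `^ m = ((u + v - 1) / v) `^ m * v `^ m.
  rewrite -powRM ?(ltW v0)//; first by rewrite divfK ?gt_eqF.
  by apply: divr_ge0; lra.
by apply: ler_wpM2r; [exact: powR_ge0 | lra].
Qed.

(** For v <= 1 Jensen is applied the other way round: u is the mean of
    (u + v - 1) / v and 1 with weights v and 1 - v. *)
Lemma mixed_difference_slope_le (R : realType) (m u v : R) : 1 <= m ->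
  0 < v -> v <= 1 -> 0 < u + v - 1 ->
  v `^ m - (1 - u `^ m) * v `^ (m - 1) <= (u + v - 1) `^ m.
Proof.
move=> m1 v0 v1 w0; set w := u + v - 1 in w0 *.
have := @powR_jensen R m v (w / v) 1 m1 _ (divr_gt0 w0 v0) ltr01.
rewrite (ltW v0) v1 => /(_ isT); rewrite powR1.
have -> : v * (w / v) + (1 - v) * 1 = u by rewrite /w; field; rewrite gt_eqF.
move=> h.
have vm : v `^ m = v * v `^ (m - 1) by rewrite mulr_powRB1//; lra.
have -> : w `^ m = v * (w / v) `^ m * v `^ (m - 1).
  have -> : w `^ m = (w / v) `^ m * v `^ m.
    by rewrite -powRM ?divr_ge0 ?(ltW v0) ?(ltW w0)// divfK ?gt_eqF.
  by rewrite vm; ring.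
rewrite vm -mulrBl; apply: ler_wpM2r; first exact: powR_ge0.
lra.
Qed.

Section mixed_difference.
Import numFieldNormedType.Exports.
Variables (R : realType) (m u : R).
Hypotheses (m1 : 1 <= m) (u0 : 0 < u).

Let H (v : R) := u `^ (m + 1) + v `^ (m + 1)
   + (1 + m^-1) * ((1 - u `^ m) * (1 - v `^ m)) - 1 - (u + v - 1) `^ (m + 1).
Let dH (v : R) :=
  (m + 1) * (v `^ m - (1 - u `^ m) * v `^ (m - 1) - (u + v - 1) `^ m).

Let is_derive_H (v : R) : 0 < v -> 0 < u + v - 1 -> is_derive v 1 H (dH v).
Proof.
move=> v0 w0; have m0 : 0 < m by exact: lt_le_trans m1.
have d1 : is_derive v 1 (fun v => v `^ (m + 1)) ((m + 1) * v `^ m).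
  have := is_derive1_powR (m + 1) v0.
  by rewrite addrK.
have d2 : is_derive v 1 (fun v => v `^ m) (m * v `^ (m - 1)).
  exact: is_derive1_powR.
have d3 : is_derive v 1 (fun v => (u + v - 1) `^ (m + 1)) ((m + 1) * (u + v - 1) `^ m).
  have da : is_derive (u + v - 1) 1 (fun v => v `^ (m + 1)) ((m + 1) * (u + v - 1) `^ m).
    have := is_derive1_powR (m + 1) w0.
    by rewrite addrK.
  have db : is_derive v 1 (fun v => u + v - 1 : R) 1.
    by apply: is_derive_eq; rewrite add0r subr0.
  have := @is_derive1_comp R (fun v => v `^ (m + 1)) (fun v => u + v - 1) v _ _ da db.
  by rewrite mulr1.
rewrite /H /dH; apply: is_derive_eq.
rewrite [in LHS]/GRing.scale/= !add0r !mul1r subr0.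
by field; rewrite gt_eqF.
Qed.

Let cont_H (a b : R) : a <= b -> 0 < a -> 0 < u + a - 1 ->
  {within `[a, b], continuous H}.
Proof.
move=> ab a0 w0; apply: derivable_within_continuous => v.
rewrite in_itv/= => /andP[av vb].
apply: (@ex_derive _ _ _ _ _ _ _ (@is_derive_H v _ _)).
  exact: lt_le_trans av.
by apply: lt_le_trans w0 _; rewrite lerD2r lerD2l.
Qed.

(** A bound on the mixed second difference of x^{m+1} at 1 with increments
    u - 1 and v - 1.  The two sides agree at v = 1, and by the two slope lemmas
    their difference H decreases before v = 1 and increases after it. *)
Lemma mixed_difference_le (v : R) : 0 < v -> 0 < u + v - 1 ->
  (u + v - 1) `^ (m + 1) <= u `^ (m + 1) + v `^ (m + 1)
   + (1 + m^-1) * ((1 - u `^ m) * (1 - v `^ m)) - 1.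
Proof.
move=> v0 w0; rewrite -subr_ge0 -/(H v).
have H1 : H 1 = 0 by rewrite /H !powR1 addrK; ring.
have w1 : 0 < u + 1 - 1 by rewrite addrK.
have mv (a b : R) : a <= b -> 0 < a -> 0 < u + a - 1 ->
    exists2 x, a <= x <= b & H b - H a = dH x * (b - a).
  move=> ab a0 wa.
  have [||x] := @MVT_segment R H dH a b ab.
  - move=> x; rewrite in_itv/= => /andP[ax xb]; apply: is_derive_H.
      exact: lt_trans ax.
    by apply: lt_trans wa _; rewrite ltrD2r ltrD2l.
  - exact: cont_H.
  by rewrite in_itv/= => xab e; exists x.
have m10 : 0 <= m + 1 by rewrite addr_ge0// (le_trans ler01).
have [v1|/ltW v1] := leP 1 v.
  have [x /andP[x1 xv]] := mv _ _ v1 ltr01 w1; rewrite H1 subr0 => ->.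
  apply: mulr_ge0; last by rewrite subr_ge0.
  apply: mulr_ge0 => //.
  by rewrite subr_ge0; exact: mixed_difference_slope_ge.
have [x /andP[x1 xv]] := mv _ _ v1 v0 w0; rewrite H1 sub0r => h.
have -> : H v = - dH x * (1 - v) by rewrite mulNr -h opprK.
apply: mulr_ge0; last by rewrite subr_ge0.
rewrite /dH -mulrN; apply: mulr_ge0 => //.
rewrite oppr_ge0 subr_le0; apply: mixed_difference_slope_le => //.
  exact: lt_le_trans x1.
by apply: lt_le_trans w0 _; rewrite lerD2r lerD2l.
Qed.

End mixed_difference.

(** The concavity bound for the power 1 - 1/m at t^m, rearranged; the factor
    1 - (1 - 1/m) t is affine in t, which [mixed_difference_le_neg] needs. *)
Lemma powR_chord (R : realType) (m t : R) : 1 <= m -> 0 < t ->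
  1 - t <= (1 - t `^ m) * (1 - (1 - m^-1) * t).
Proof.
move=> m1 t0; have m0 : 0 < m by exact: lt_le_trans m1.
have im1 : m^-1 <= 1 by rewrite invf_le1.
have im0 : 0 < m^-1 by rewrite invr_gt0.
have := @powR_concave1 R (1 - m^-1) (t `^ m) _ _ (powR_ge0 _ _).
rewrite -powRrM mulrBr mulr1 divff ?gt_eqF// => /(_ ltac:(lra) ltac:(lra)).
have : t * t `^ (m - 1) = t `^ m by rewrite mulr_powRB1// ltW.
by set x := t `^ m; set y := t `^ (m - 1); set z := m^-1 => h1 h2; nra.
Qed.

(** When u + v = 1, the instances of [powR_chord] at u and v, multiplied by
    1 - v^m and 1 - u^m, add up to the claim because the two affine factors sum
    to 1 + 1/m.  When u + v < 1 the missing multiple of 1 - u - v is paid for by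
    u^m v^m <= (1/m) (1 - u^m) (1 - v^m), which follows from the tangent to x^m
    at u. *)
Lemma mixed_difference_le_neg (R : realType) (m u v : R) : 1 <= m -> 0 < u -> 0 < v ->
  u + v - 1 <= 0 ->
  0 <= u `^ (m + 1) + v `^ (m + 1)
   + (1 + m^-1) * ((1 - u `^ m) * (1 - v `^ m)) - 1.
Proof.
move=> m1 u0 v0 w0; have m0 : 0 < m by exact: lt_le_trans m1.
have cu := powR_chord m1 u0; have cv := powR_chord m1 v0.
have um : u `^ m <= u by apply: ge1r_powR => //; lra.
have vm : v `^ m <= v by apply: ge1r_powR => //; lra.
have tu := @powR_tangent R m 1 u m1 ler01 u0.
have uu : u * u `^ (m - 1) = u `^ m by rewrite mulr_powRB1// ltW.
have im1 : m^-1 <= 1 by rewrite invf_le1.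
have im0 : 0 < m^-1 by rewrite invr_gt0.
have p1 : u `^ (m + 1) = u `^ m * u.
  by rewrite addrC powR_1D ?(ltW u0) ?(ltW m0)// mulrC.
have p2 : v `^ (m + 1) = v `^ m * v.
  by rewrite addrC powR_1D ?(ltW v0) ?(ltW m0)// mulrC.
rewrite p1 p2; move: tu; rewrite powR1.
have : 0 < u `^ m by rewrite powR_gt0.
have : 0 < v `^ m by rewrite powR_gt0.
have : 0 < u `^ (m - 1) by rewrite powR_gt0.
set x := u `^ (m-1) in uu *; set U := u `^ m in um cu uu *.
set V := v `^ m in vm cv *; set z := m^-1 in im0 im1 cu cv *.
move=> x0 V0 U0 tu.
have mz : m * z = 1 by rewrite /z divff ?gt_eqF.
(* v^m <= v <= 1 - u and m u^{m-1} (1 - u) <= 1 - u^m *)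
have hUV : U * V <= z * ((1 - U) * (1 - V)).
  have h1 : m * x * (1 - u) * u <= (1 - U) * (1 - V).
    by apply: ler_pM; [apply: mulr_ge0; [apply: mulr_ge0|]|..]; lra.
  have h2 : z * (m * x * (1 - u) * u) <= z * ((1 - U) * (1 - V)).
    by rewrite ler_pM2l.
  apply: le_trans h2.
  have -> : z * (m * x * (1 - u) * u) = (m * z) * ((u * x) * (1 - u)) by ring.
  by rewrite mz mul1r uu ler_pM2l//; lra.
have hu : (1 - u) * (1 - V) <= (1 - U) * (1 - (1 - z) * u) * (1 - V).
  by apply: ler_wpM2r => //; lra.
have hv : (1 - v) * (1 - U) <= (1 - V) * (1 - (1 - z) * v) * (1 - U).
  by apply: ler_wpM2r => //; lra.
have hs : (1 - u - v) * (U * V) <= (1 - u - v) * (z * ((1 - U) * (1 - V))).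
  by apply: ler_wpM2l => //; lra.
lra.
Qed.

(** The variable a occurs only in a^{1+r} and in the term on the left.
    Minimizing over it by Young's inequality with exponents 1 + r and
    (1 + r) / r, and writing u = b^r, v = c^r, m = 1/r, leaves exactly the bound on the mixed second difference
    when u + v > 1; when u + v <= 1 the left side is nonpositive. *)
Lemma bregman_powR1 (R : realType) (r a b c : R) : 0 < r -> r <= 1 ->
  0 < a -> 0 < b -> 0 < c ->
  (1 + r) * a * (b `^ r + c `^ r - 1) <= a `^ (1 + r)
   + r * (b `^ (1 + r) + c `^ (1 + r) + r + (1 + r) * (b * c - c - b)).
Proof.
move=> r0 r1 a0 b0 c0; have p0 : 0 < 1 + r by lra.
have m1 : 1 <= r^-1 by rewrite invf_ge1.
have rm : r * r^-1 = 1 by rewrite divff ?gt_eqF.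
have u0 : 0 < b `^ r by rewrite powR_gt0.
have v0 : 0 < c `^ r by rewrite powR_gt0.
have rK x : 0 < x -> (x `^ r) `^ r^-1 = x.
  by move=> x0; rewrite -powRrM rm powRr1// ltW.
have e1 : r * (r^-1 + 1) = 1 + r by rewrite mulrDr rm mulr1.
have rK1 x : (x `^ r) `^ (r^-1 + 1) = x `^ (1 + r) by rewrite -powRrM e1.
have [w0|w0] := leP (b `^ r + c `^ r - 1) 0.
  have := mixed_difference_le_neg m1 u0 v0 w0; rewrite !rK// !rK1 invrK => h.
  have h1 : (1 + r) * a * (b `^ r + c `^ r - 1) <= 0.
    by apply: mulr_ge0_le0 => //; rewrite mulr_ge0// ltW.
  have h2 : 0 <= a `^ (1 + r) := powR_ge0 _ _.
  have h3 := mulr_ge0 (ltW r0) h.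
  lra.
have := mixed_difference_le m1 u0 v0 w0; rewrite !rK// !rK1 invrK.
set w := b `^ r + c `^ r - 1 in w0 *.
move: (b `^ (1 + r)) (c `^ (1 + r)) => B C h.
have q0 : 0 < r^-1 + 1 by rewrite addr_gt0// invr_gt0.
have := @conjugate_powR R a w (1 + r) (r^-1 + 1) (ltW a0) (ltW w0) p0 q0.
have -> : (r^-1 + 1)^-1 = r / (1 + r).
  by rewrite -e1 invfM mulrA divff ?gt_eqF ?mul1r.
have -> : (1 + r)^-1 + r / (1 + r) = 1 by rewrite -{1}[(1 + r)^-1]mul1r -mulrDl divff ?gt_eqF.
move=> /(_ erefl); move: (w `^ (r^-1 + 1)) (a `^ (1 + r)) h => W A h y.
have : (1 + r) * (a * w) <= A + r * W.
  have := y; rewrite -(ler_pM2l p0) mulrDr => /le_trans; apply.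
  rewrite le_eqVlt; apply/orP; left; apply/eqP.
  by field; rewrite gt_eqF.
by have := h; rewrite -(ler_pM2l r0); lra.
Qed.

(** With D(a, b) = a^{1+r} + r b^{1+r} - (1 + r) a b^r the Bregman divergence of
    x^{1+r}, this says that D(a, b) is at least the value at (a, b) of the
    affine function tangent to D at (c, d): the joint convexity of D, in the
    form that can be integrated.  It is the homogeneous version of
    [bregman_powR1]. *)
Lemma bregman_powR (R : realType) (r a b c d : R) : 0 < r -> r <= 1 ->
  0 < a -> 0 < b -> 0 < c -> 0 < d ->
  (1 + r) * (a * b `^ r + a * c `^ r - a * d `^ r) <=
  a `^ (1 + r) + r * (b `^ (1 + r) + c `^ (1 + r) + r * d `^ (1 + r)
    + (1 + r) * (b * c * d `^ (r - 1) - c * d `^ r - b * d `^ r)).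
Proof.
move=> r0 r1 a0 b0 c0 d0.
have := @bregman_powR1 R r (a / d) (b / d) (c / d) r0 r1
  (divr_gt0 a0 d0) (divr_gt0 b0 d0) (divr_gt0 c0 d0).
have eM x s : 0 < x -> x `^ s = (x / d) `^ s * d `^ s.
  by move=> x0; rewrite -powRM ?(ltW d0) ?divr_ge0 ?(ltW d0) ?(ltW x0)// divfK ?gt_eqF.
rewrite !(eM a)// !(eM b)// !(eM c)//.
have d1 : d `^ r = d `^ (r - 1) * d.
  by rewrite mulrC mulr_powRB1// ltW.
have d2 : d `^ (1 + r) = d `^ (r - 1) * d * d.
  by rewrite powR_1D ?(ltW d0) ?(ltW r0)// d1; ring.
have D0 : 0 < d `^ (r - 1) * d * d by rewrite !mulr_gt0 ?powR_gt0.
rewrite -(ler_pM2r D0) d1 d2.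
have e x : x = x / d * d by rewrite divfK ?gt_eqF.
rewrite [in X in _ -> X](e a) [in X in _ -> X](e b) [in X in _ -> X](e c).
by rewrite !(mulfK (lt0r_neq0 d0)); lra.
Qed.

(** * Bounded measurable functions *)

Definition bounded_mfun {d} {T : measurableType d} {R : realType} (g : T -> R) : Prop :=
  measurable_fun [set: T] g /\ exists M, forall x, `|g x| <= M.

(** Being bounded away from 0 makes all real powers bounded, negative ones
    included. *)
Definition posbounded_mfun {d} {T : measurableType d} {R : realType} (g : T -> R) : Prop :=
  measurable_fun [set: T] g /\
  exists e M : R, 0 < e /\ forall x, e <= g x <= M.

Section bounded_functions.
Context {d} {T : measurableType d} {R : realType}.
Implicit Types f g : T -> R.

Lemma bmf_cst (c : R) : bounded_mfun (fun _ : T => c).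
Proof. by split; [exact: measurable_cst | exists `|c|]. Qed.

Lemma bmfD f g : bounded_mfun f -> bounded_mfun g -> bounded_mfun (fun x => f x + g x).
Proof.
move=> [mf [M fM]] [mg [N gN]]; split; first exact: measurable_funD.
by exists (M + N) => x; rewrite (le_trans (ler_normD _ _))// lerD.
Qed.

Lemma bmfM f g : bounded_mfun f -> bounded_mfun g -> bounded_mfun (fun x => f x * g x).
Proof.
move=> [mf [M fM]] [mg [N gN]]; split; first exact: measurable_funM.
by exists (M * N) => x; rewrite normrM ler_pM.
Qed.

Lemma bmfZ (c : R) f : bounded_mfun f -> bounded_mfun (fun x => c * f x).
Proof. exact/bmfM/bmf_cst. Qed.

Lemma bmfB f g : bounded_mfun f -> bounded_mfun g -> bounded_mfun (fun x => f x - g x).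
Proof.
move=> bf bg; have := bmfD bf (bmfZ (-1) bg).
by under eq_fun do rewrite mulN1r.
Qed.

Lemma bmf_max0 f : bounded_mfun f -> bounded_mfun (fun x => Num.max (f x) 0).
Proof.
move=> [mf [M fM]]; split; first exact: measurable_maxr.
exists M => x; apply: le_trans (fM x); have := fM x.
by case: (leP (f x) 0) => h; rewrite ?normr0.
Qed.

Lemma pbmf_bmf f : posbounded_mfun f -> bounded_mfun f.
Proof.
move=> [mf [e [M [e0 h]]]]; split => //; exists M => x.
by have /andP[h1 h2] := h x; rewrite gtr0_norm// (lt_le_trans e0).
Qed.

Lemma pbmf_gt0 f x : posbounded_mfun f -> 0 < f x.
Proof. by move=> [_ [e [M [e0 /(_ x)/andP[h _]]]]]; exact: lt_le_trans h. Qed.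

Lemma pbmf_powR f s : posbounded_mfun f -> posbounded_mfun (fun x => f x `^ s).
Proof.
move=> [mf [e [M [e0 h]]]]; split.
  exact: (@measurableT_comp _ _ _ _ _ _ (@powR R ^~ s) _ f).
have [s0|s0] := leP 0 s.
  exists (e `^ s), (M `^ s); split; first exact: powR_gt0.
  move=> x; have /andP[h1 h2] := h x.
  have fx : 0 < f x by exact: lt_le_trans h1.
  by rewrite !ge0_ler_powR ?nnegrE ?(ltW e0) ?(ltW fx)// (le_trans (ltW fx)).
have s0' : 0 <= - s by rewrite oppr_ge0 ltW.
exists ((`|M| + 1) `^ s), (e `^ s); split; first by rewrite powR_gt0 ?ltr_wpDl.
move=> x; have /andP[h1 h2] := h x.
have fx : 0 < f x by exact: lt_le_trans h1.
have M1 : f x <= `|M| + 1.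
  by rewrite (le_trans h2)// (le_trans (ler_norm _))// lerDl.
rewrite -[s]opprK 3!(powRN _ (- s)) !lef_pV2 ?posrE ?powR_gt0 ?ltr_wpDl//.
by rewrite !ge0_ler_powR ?nnegrE ?(ltW e0) ?(ltW fx)// addr_ge0.
Qed.

Lemma bmf_comp {d1} {S : measurableType d1} (w : S -> T) f :
  measurable_fun [set: S] w -> bounded_mfun f -> bounded_mfun (f \o w).
Proof.
by move=> mw [mf [M fM]]; split; [exact: measurableT_comp | exists M => s /=].
Qed.

Variable m : probability T R.

Lemma bmf_integrable f : bounded_mfun f -> m.-integrable [set: T] (EFin \o f).
Proof.
move=> [mf [M fM]]; apply: measurable_bounded_integrable => //.
  by rewrite -ge0_fin_numE ?fin_num_measure.
exists M; split; first exact: num_real.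
by move=> x Mx y _ /=; rewrite (le_trans (fM y))// ltW.
Qed.

Lemma bmf_integralE f : bounded_mfun f ->
  (\int[m]_x (f x)%:E)%E = (\int[m]_x f x)%:E.
Proof.
by move=> bf; rewrite fineK//; apply: integrable_fin_num => //; exact: bmf_integrable.
Qed.

Lemma integral_bmfD f g : bounded_mfun f -> bounded_mfun g ->
  \int[m]_x (f x + g x) = \int[m]_x f x + \int[m]_x g x.
Proof. by move=> bf bg; rewrite RintegralD//; exact: bmf_integrable. Qed.

Lemma integral_bmfB f g : bounded_mfun f -> bounded_mfun g ->
  \int[m]_x (f x - g x) = \int[m]_x f x - \int[m]_x g x.
Proof. by move=> bf bg; rewrite RintegralB//; exact: bmf_integrable. Qed.

Lemma integral_bmfZ c f : bounded_mfun f ->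
  \int[m]_x (c * f x) = c * \int[m]_x f x.
Proof. by move=> bf; rewrite RintegralZl//; exact: bmf_integrable. Qed.

Lemma integral_bmf_cst (c : R) : \int[m]_x c = c.
Proof.
rewrite Rintegral_cst// [X in fine X](_ : _ = 1%E) ?mulr1//.
exact: probability_setT.
Qed.

Lemma le_integral_bmf f g : bounded_mfun f -> bounded_mfun g -> (forall x, f x <= g x) ->
  \int[m]_x f x <= \int[m]_x g x.
Proof. by move=> bf bg h; apply: le_Rintegral => //; exact: bmf_integrable. Qed.

End bounded_functions.

Section bounded_fubini.
Context {d1 d2} {T1 : measurableType d1} {T2 : measurableType d2} {R : realType}.
Variables (m1 : probability T1 R) (m2 : probability T2 R).

Lemma bmf_sect (k : T1 * T2 -> R) x : bounded_mfun k -> bounded_mfun (fun t => k (x, t)).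
Proof.
move=> [mk [M kM]]; split; last by exists M.
exact: (@measurableT_comp _ _ _ _ _ _ k).
Qed.

Lemma bmf_fubini (k : T1 * T2 -> R) : bounded_mfun k -> bounded_mfun (fun x => \int[m2]_t k (x, t)).
Proof.
move=> bk; split.
  rewrite (_ : (fun _ => _) = fine \o fubini_F m2 (EFin \o k))//.
  apply: measurableT_comp => //; apply: (measurable_fubini_F (m1 := m1)).
  exact: (@bmf_integrable _ _ _ (m1 \x m2)%E).
have [mk [M kM]] := bk.
exists M => x; apply: le_trans (le_normr_Rintegral _ _) _ => //.
  by apply: bmf_integrable; exact: bmf_sect.
rewrite -[leRHS](integral_bmf_cst m2); apply: le_integral_bmf => //.
  split; last by exists M => t; rewrite normr_id.
  by apply: measurableT_comp => //; case: (bmf_sect x bk).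
exact: bmf_cst.
Qed.

Lemma pbmf_fubini (k : T1 * T2 -> R) :
  posbounded_mfun k -> posbounded_mfun (fun x => \int[m2]_t k (x, t)).
Proof.
move=> pk; have bk := pbmf_bmf pk; split; first by case: (bmf_fubini bk).
have [mk [e [M [e0 h]]]] := pk; exists e, M; split => // x.
have bx := bmf_sect x bk.
apply/andP; split.
  rewrite -[leLHS](integral_bmf_cst m2); apply: le_integral_bmf bx _.
    exact: bmf_cst.
  by move=> t; have /andP[] := h (x, t).
rewrite -[leRHS](integral_bmf_cst m2); apply: le_integral_bmf bx _ _.
  exact: bmf_cst.
by move=> t; have /andP[] := h (x, t).
Qed.

Lemma Rfubini (k : T1 * T2 -> R) : bounded_mfun k ->
  \int[m1]_x \int[m2]_t k (x, t) = \int[(m1 \x m2)%E]_z k z.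
Proof.
move=> bk; have ik := @bmf_integrable _ _ _ (m1 \x m2)%E _ bk.
rewrite {1}/Rintegral [in RHS]/Rintegral -(integral12_prod_meas1 ik).
congr fine; apply: eq_integral => x _.
by rewrite /fubini_F /= bmf_integralE//; exact: bmf_sect.
Qed.

End bounded_fubini.

Lemma Rfubini_swap {d1 d2} {T1 : measurableType d1} {T2 : measurableType d2}
  {R : realType} (m1 : probability T1 R) (m2 : probability T2 R)
  (k : T1 * T2 -> R) : bounded_mfun k ->
  \int[m1]_x \int[m2]_t k (x, t) = \int[m2]_t \int[m1]_x k (x, t).
Proof.
move=> bk; have ik := @bmf_integrable _ _ _ (m1 \x m2)%E _ bk.
rewrite Rfubini// /Rintegral -(integral21_prod_meas1 ik).
congr fine; apply: eq_integral => x _.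
rewrite /fubini_G /= bmf_integralE//; have [mk [M kM]] := bk; split; last by exists M.
exact: (@measurableT_comp _ _ _ _ _ _ k).
Qed.

(** * Resampling one coordinate and conditional means *)

Definition resample {n : nat} {T : Type} (i : 'I_n) (x : n.-tuple T) (t : T) :
  n.-tuple T := [tuple (if j == i then t else tnth x j) | j < n].

Lemma resample_idem (n : nat) (T : Type) (i : 'I_n) (x : n.-tuple T) u t :
  resample i (resample i x u) t = resample i x t.
Proof. by apply: eq_from_tnth => j; rewrite !tnth_mktuple; case: eqP. Qed.

Lemma resample_comm (n : nat) (T : Type) (i j : 'I_n) (x : n.-tuple T) u t :
  i != j -> resample i (resample j x u) t = resample j (resample i x t) u.
Proof.
move=> ij; apply: eq_from_tnth => k; rewrite !tnth_mktuple.
by case: eqP => [->|//]; rewrite (negbTE ij).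
Qed.

Lemma measurable_resample (n : nat) d (T : measurableType d) (i : 'I_n) :
  measurable_fun [set: n.-tuple T * T] (fun z => resample i z.1 z.2).
Proof.
apply/measurable_fun_tnthP => j.
rewrite (_ : _ \o _ = fun z => if j == i then z.2 else tnth z.1 j); last first.
  by apply/funext => z /=; rewrite tnth_mktuple.
case: (j == i); first exact: measurable_snd.
by apply: (@measurableT_comp _ _ _ _ _ _ (fun x => tnth x j)) => //; exact: measurable_tnth.
Qed.

Definition indep_of {n : nat} {T U : Type} (i : 'I_n) (g : n.-tuple T -> U) :=
  forall x t, g (resample i x t) = g x.

Section conditional_expectation_operators.
Context {d} {T : measurableType d} {R : realType} {n : nat}.
Variables (mu : probability (n.-tuple T) R) (nu : 'I_n -> probability T R).
Implicit Types (g h u v Y : n.-tuple T -> R) (i : 'I_n).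

(** Independence of the coordinates, in the only form that the tensorization
    needs: replacing the i-th coordinate by an independent value drawn from
    [nu i] does not change the law [mu]. *)
Definition resample_invariant := forall i (A : set (n.-tuple T)), measurable A ->
  (mu \x nu i)%E ((fun z => resample i z.1 z.2) @^-1` A) = mu A.

(** The conditional expectation given the coordinates other than the i-th. *)
Definition coord_mean i g x : R := \int[nu i]_t g (resample i x t).

Lemma bmf_resample i g : bounded_mfun g -> bounded_mfun (fun z : _ * T => g (resample i z.1 z.2)).
Proof. exact: (bmf_comp (measurable_resample i)). Qed.

Lemma pbmf_resample i g :
  posbounded_mfun g -> posbounded_mfun (fun z : _ * T => g (resample i z.1 z.2)).
Proof.
move=> [mg [e [M [e0 gM]]]]; split; last by exists e, M.
exact: (@measurableT_comp _ _ _ _ _ _ g _ _ mg (measurable_resample i)).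
Qed.

Lemma pbmf_coord_mean i g : posbounded_mfun g -> posbounded_mfun (coord_mean i g).
Proof. by move=> /(pbmf_resample i)/(pbmf_fubini mu (nu i)). Qed.

Lemma indep_coord_mean i g : indep_of i (coord_mean i g).
Proof.
by move=> x t; rewrite /coord_mean; under eq_Rintegral do rewrite resample_idem.
Qed.

Lemma indep_coord_mean_other i j g : indep_of i g -> indep_of i (coord_mean j g).
Proof.
have [->|ij] := eqVneq i j; first by move=> _; exact: indep_coord_mean.
move=> ig x t; rewrite /coord_mean; apply: eq_Rintegral => u _.
by rewrite resample_comm 1?eq_sym// ig.
Qed.

Lemma coord_mean_mulr i u v : bounded_mfun u -> indep_of i v ->
  coord_mean i (fun x => u x * v x) = (fun x => coord_mean i u x * v x).
Proof.
move=> bu iv; apply/funext => x; rewrite /coord_mean.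
under eq_Rintegral do rewrite iv mulrC.
by rewrite integral_bmfZ 1?mulrC//; exact: (bmf_sect x (bmf_resample i bu)).
Qed.

Hypothesis inv : resample_invariant.

Lemma integral_resample i g : bounded_mfun g ->
  \int[(mu \x nu i)%E]_z g (resample i z.1 z.2) = \int[mu]_x g x.
Proof.
move=> bg; pose phi (z : n.-tuple T * T) := resample i z.1 z.2.
have mphi : measurable_fun setT phi by exact: measurable_resample.
have ig := @bmf_integrable _ _ _ (mu \x nu i)%E _ (bmf_resample i bg).
have mg : measurable_fun setT (EFin \o g) by apply/measurable_EFinP; case: bg.
have := @integral_pushforward _ _ _ _ _ _ mphi (mu \x nu i)%E setT (EFin \o g) mg ig measurableT.
rewrite /Rintegral preimage_setT => /= <-; congr fine.
by apply: eq_measure_integral => A mA _; exact: inv.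
Qed.

Lemma integral_coord_mean i g : bounded_mfun g -> \int[mu]_x coord_mean i g x = \int[mu]_x g x.
Proof.
move=> bg; rewrite -(integral_resample i bg) -Rfubini//.
exact: bmf_resample.
Qed.

Lemma integral_coord_mean_mulr i u v : bounded_mfun u -> bounded_mfun v -> indep_of i v ->
  \int[mu]_x (coord_mean i u x * v x) = \int[mu]_x (u x * v x).
Proof.
move=> bu bv iv; rewrite -(integral_coord_mean i (bmfM bu bv)).
by apply: eq_Rintegral => x _; rewrite coord_mean_mulr.
Qed.

Definition coord_means (s : seq 'I_n) g := foldr coord_mean g s.

Lemma pbmf_coord_means s g : posbounded_mfun g -> posbounded_mfun (coord_means s g).
Proof. by move=> pg; elim: s => //= i s; exact: pbmf_coord_mean. Qed.

Lemma indep_coord_means s i g : i \in s -> indep_of i (coord_means s g).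
Proof.
elim: s => //= j s IH; rewrite inE => /predU1P[->|/IH]; first exact: indep_coord_mean.
exact: indep_coord_mean_other.
Qed.

Lemma integral_coord_means_mulr s u v : posbounded_mfun u -> bounded_mfun v ->
  (forall i, i \in s -> indep_of i v) ->
  \int[mu]_x (coord_means s u x * v x) = \int[mu]_x (u x * v x).
Proof.
move=> pu bv; elim: s => //= i s IH iv.
rewrite integral_coord_mean_mulr//; last by apply: iv; rewrite mem_head.
  by apply: IH => j js; apply: iv; rewrite inE js orbT.
exact/pbmf_bmf/pbmf_coord_means.
Qed.

(** Averaging over every coordinate leaves a function that ignores all of them,
    hence a constant, and averaging preserves the integral. *)
Lemma coord_means_enum g : posbounded_mfun g ->
  coord_means (enum 'I_n) g = (fun=> \int[mu]_x g x).
Proof.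
move=> pg; have ind i : indep_of i (coord_means (enum 'I_n) g).
  by apply: indep_coord_means; rewrite mem_enum.
have cst x y : coord_means (enum 'I_n) g x = coord_means (enum 'I_n) g y.
  (* [mix s x] overwrites the coordinates of [x] listed in [s] by those of [y]. *)
  pose mix (s : seq 'I_n) z := foldr (fun i z => resample i z (tnth y i)) z s.
  have mixE s : coord_means (enum 'I_n) g (mix s x) = coord_means (enum 'I_n) g x.
    by elim: s => //= i s <-; rewrite ind.
  rewrite -(mixE (enum 'I_n)); congr (coord_means _ _ _).
  have mixt s i : tnth (mix s x) i = if i \in s then tnth y i else tnth x i.
    elim: s => //= j s IH; rewrite tnth_mktuple inE IH.
    by case: eqP => [->|].
  by apply: eq_from_tnth => i; rewrite mixt mem_enum.
apply/funext => x; have := @integral_coord_means_mulr (enum 'I_n) g (fun=> 1) pg.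
move=> /(_ (bmf_cst _)).
rewrite (eq_Rintegral mu (g := fun=> coord_means (enum 'I_n) g x)); last first.
  by move=> y _; rewrite mulr1; exact: cst.
rewrite integral_bmf_cst => -> //.
by under eq_Rintegral do rewrite mulr1.
Qed.

End conditional_expectation_operators.

(** * Tensorization of the power entropy *)

(** The linear bookkeeping of [entropy_coord_means]: [F1] to [F10] are the ten
    monomials of [bregman_powR], in order, and the hypotheses on integrals say
    that every mixed monomial has the integral of a pure one. *)
Lemma le_integral_bregman {d} {T : measurableType d} {R : realType}
  (m : probability T R) (r : R) (F1 F2 F3 F4 F5 F6 F7 F8 F9 F10 : T -> R) :
  bounded_mfun F1 -> bounded_mfun F2 -> bounded_mfun F3 -> bounded_mfun F4 ->
  bounded_mfun F5 -> bounded_mfun F6 -> bounded_mfun F7 ->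
  bounded_mfun F8 -> bounded_mfun F9 -> bounded_mfun F10 ->
  (forall x, (1 + r) * (F1 x + F2 x - F3 x) <= F4 x + r * (F5 x + F6 x + r * F7 x
     + (1 + r) * (F8 x - F9 x - F10 x))) ->
  \int[m]_x F1 x = \int[m]_x F5 x ->
  \int[m]_x F2 x = \int[m]_x F6 x ->
  \int[m]_x F3 x = \int[m]_x F7 x ->
  \int[m]_x F8 x = \int[m]_x F7 x ->
  \int[m]_x F9 x = \int[m]_x F7 x ->
  \int[m]_x F10 x = \int[m]_x F7 x ->
  \int[m]_x F5 x - \int[m]_x F7 x <= \int[m]_x F4 x - \int[m]_x F6 x.
Proof.
move=> b1 b2 b3 b4 b5 b6 b7 b8 b9 b10.
have c1 := bmfD b1 b2; have c2 := bmfB c1 b3; have c3 := bmfZ (1 + r) c2.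
have c4 := bmfB b8 b9; have c5 := bmfB c4 b10; have c6 := bmfZ (1 + r) c5.
have c7 := bmfD b5 b6; have c8 := bmfZ r b7; have c9 := bmfD c7 c8.
have c10 := bmfD c9 c6; have c11 := bmfZ r c10; have c12 := bmfD b4 c11.
move=> /(le_integral_bmf m c3 c12).
rewrite (integral_bmfZ _ _ c2) (integral_bmfB _ c1 b3) (integral_bmfD _ b1 b2).
rewrite (integral_bmfD _ b4 c11) (integral_bmfZ _ _ c10) (integral_bmfD _ c9 c6).
rewrite (integral_bmfD _ c7 c8) (integral_bmfD _ b5 b6) (integral_bmfZ _ _ b7).
rewrite (integral_bmfZ _ _ c5) (integral_bmfB _ c4 b10) (integral_bmfB _ b8 b9).
by move=> H E1 E2 E3 E8 E9 E10; move: H; rewrite E1 E2 E3 E8 E9 E10; lra.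
Qed.

Section tensorization.
Context {d} {T : measurableType d} {R : realType} {n : nat}.
Variables (mu : probability (n.-tuple T) R) (nu : 'I_n -> probability T R).
Hypothesis inv : resample_invariant mu nu.
Implicit Types (Y : n.-tuple T -> R) (i : 'I_n).

Let tele (a b c x y : R) : b - c <= x -> a - b <= y -> a - c <= x + y.
Proof. lra. Qed.

Let indep_powR i (g : n.-tuple T -> R) s :
  indep_of i g -> indep_of i (fun x => g x `^ s).
Proof. by move=> ig x t; rewrite ig. Qed.

(** Averaging over the coordinates in [s] can only decrease the entropy with
    respect to the i-th coordinate.  Put g, h for the averages of Y over [s] and
    over i, and e for the average of g over i, and integrate [bregman_powR] at
    (Y, g, h, e).  A factor that ignores the averaged coordinates can be pulled
    out of an average, so every mixed term integrates to the mean of g^{1+r},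
    h^{1+r} or e^{1+r}. *)
Lemma entropy_coord_means (r : R) s i Y : 0 < r -> r <= 1 -> posbounded_mfun Y ->
  \int[mu]_x coord_means nu s Y x `^ (1 + r)
    - \int[mu]_x coord_mean nu i (coord_means nu s Y) x `^ (1 + r)
  <= \int[mu]_x Y x `^ (1 + r) - \int[mu]_x coord_mean nu i Y x `^ (1 + r).
Proof.
move=> r0 r1 pY.
set g := coord_means nu s Y; set h := coord_mean nu i Y; set e := coord_mean nu i g.
have pg : posbounded_mfun g by exact: pbmf_coord_means.
have ph : posbounded_mfun h by exact: pbmf_coord_mean.
have pe : posbounded_mfun e by exact: pbmf_coord_mean.
have mulX (f : n.-tuple T -> R) : posbounded_mfun f -> forall x, f x * f x `^ r = f x `^ (1 + r).
  by move=> pf x; rewrite powR_1D// ltW// pbmf_gt0.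
have eS x : e x * e x `^ (r - 1) = e x `^ r.
  by rewrite mulr_powRB1// ltW// pbmf_gt0.
have bP (f : n.-tuple T -> R) t : posbounded_mfun f -> bounded_mfun (fun x => f x `^ t).
  by move=> pf; exact/pbmf_bmf/pbmf_powR.
have [bY bg bh] := And3 (pbmf_bmf pY) (pbmf_bmf pg) (pbmf_bmf ph).
have ig j : j \in s -> indep_of j g by exact: indep_coord_means.
have ie j : j \in i :: s -> indep_of j e by exact: (@indep_coord_means _ _ _ _ _ (i :: s)).
have iei : indep_of i e by exact: indep_coord_mean.
have ihi : indep_of i h by exact: indep_coord_mean.
have iY1 : \int[mu]_x (Y x * g x `^ r) = \int[mu]_x g x `^ (1 + r).
  transitivity (\int[mu]_x (g x * g x `^ r)).
    by apply/esym/(integral_coord_means_mulr inv pY (bP g r pg)) => j /ig/indep_powR.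
  by apply: eq_Rintegral => x _; rewrite mulX.
have iY2 : \int[mu]_x (Y x * h x `^ r) = \int[mu]_x h x `^ (1 + r).
  transitivity (\int[mu]_x (h x * h x `^ r)).
    exact/esym/(integral_coord_mean_mulr inv bY (bP h r ph))/indep_powR.
  by apply: eq_Rintegral => x _; rewrite mulX.
have iY4 : \int[mu]_x (g x * e x `^ r) = \int[mu]_x e x `^ (1 + r).
  transitivity (\int[mu]_x (e x * e x `^ r)).
    exact/esym/(integral_coord_mean_mulr inv bg (bP e r pe))/indep_powR.
  by apply: eq_Rintegral => x _; rewrite mulX.
have iY3 : \int[mu]_x (Y x * e x `^ r) = \int[mu]_x e x `^ (1 + r).
  rewrite -iY4; apply/esym/(integral_coord_means_mulr inv pY (bP e r pe)) => j js.
  by apply: indep_powR; apply: ie; rewrite inE js orbT.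
have iY5 : \int[mu]_x (h x * e x `^ r) = \int[mu]_x e x `^ (1 + r).
  rewrite -iY3; exact/(integral_coord_mean_mulr inv bY (bP e r pe))/indep_powR.
(* In the product g h e^{r-1} only g depends on the i-th coordinate; averaging
   it over i gives e, and e e^{r-1} = e^r. *)
have iY6 : \int[mu]_x (g x * h x * e x `^ (r - 1)) = \int[mu]_x e x `^ (1 + r).
  rewrite -iY3.
  have bge := bmfM bg (bP e (r - 1) pe).
  transitivity (\int[mu]_x (h x * (g x * e x `^ (r - 1)))).
    by apply: eq_Rintegral => x _; ring.
  rewrite -(integral_coord_mean inv i (bmfM bh bge)).
  transitivity (\int[mu]_x (h x * e x `^ r)).
    suff -> : coord_mean nu i (fun x => h x * (g x * e x `^ (r - 1))) =
        (fun x => h x * e x `^ r) by [].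
    transitivity (coord_mean nu i (fun x => (g x * e x `^ (r - 1)) * h x)).
      by congr coord_mean; apply/funext => x; rewrite mulrC.
    rewrite (coord_mean_mulr nu bge ihi); apply/funext => x.
    rewrite (coord_mean_mulr nu bg (indep_powR (r - 1) iei)).
    by rewrite -/e eS mulrC.
  exact/(integral_coord_mean_mulr inv bY (bP e r pe))/indep_powR.
have pw x := @bregman_powR R r (Y x) (g x) (h x) (e x) r0 r1 (pbmf_gt0 x pY)
  (pbmf_gt0 x pg) (pbmf_gt0 x ph) (pbmf_gt0 x pe).
exact: (le_integral_bregman
  (bmfM bY (bP g r pg)) (bmfM bY (bP h r ph)) (bmfM bY (bP e r pe))
  (bP Y (1 + r) pY) (bP g (1 + r) pg) (bP h (1 + r) ph) (bP e (1 + r) pe)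
  (bmfM (bmfM bg bh) (bP e (r - 1) pe)) (bmfM bh (bP e r pe))
  (bmfM bg (bP e r pe)) pw iY1 iY2 iY3 iY6 iY5 iY4).
Qed.

(** Averaging out the coordinates one at a time telescopes, each step being
    bounded by [entropy_coord_means]. *)
Lemma entropy_tensorization (r : R) Y : 0 < r -> r <= 1 -> posbounded_mfun Y ->
  \int[mu]_x Y x `^ (1 + r) - (\int[mu]_x Y x) `^ (1 + r)
  <= \sum_(i < n) (\int[mu]_x Y x `^ (1 + r) - \int[mu]_x coord_mean nu i Y x `^ (1 + r)).
Proof.
move=> r0 r1 pY.
have H s : \int[mu]_x Y x `^ (1 + r) - \int[mu]_x coord_means nu s Y x `^ (1 + r)
  <= \sum_(i <- s) (\int[mu]_x Y x `^ (1 + r) - \int[mu]_x coord_mean nu i Y x `^ (1 + r)).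
  elim: s => [|i s IH]; first by rewrite big_nil /= subrr.
  rewrite big_cons /=.
  exact: (tele (entropy_coord_means s i r0 r1 pY) IH).
have := H (enum 'I_n); rewrite (coord_means_enum inv pY) integral_bmf_cst.
by rewrite big_enum.
Qed.

(** With h the mean of Y over the i-th coordinate, the entropy is at most
    E [(Y - h) Y^r], a covariance, and that is E [(Y - Y') Y^r].  Symmetrizing
    in Y and Y' gives E [(Y - Y')_+ (Y^r - Y'^r)_+], since Y^r is nondecreasing
    in Y. *)
Lemma entropy_le_covariance (r : R) i Y : 0 < r -> r <= 1 -> posbounded_mfun Y ->
  \int[mu]_x Y x `^ (1 + r) - \int[mu]_x coord_mean nu i Y x `^ (1 + r)
  <= \int[mu]_x \int[nu i]_t (Num.max (Y x - Y (resample i x t)) 0 *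
        Num.max (Y x `^ r - Y (resample i x t) `^ r) 0).
Proof.
move=> r0 r1 pY; set h := coord_mean nu i Y.
have ph : posbounded_mfun h by exact: pbmf_coord_mean.
have bP (f : n.-tuple T -> R) t : posbounded_mfun f -> bounded_mfun (fun x => f x `^ t).
  by move=> pf; exact/pbmf_bmf/pbmf_powR.
have ihi : indep_of i h by exact: indep_coord_mean.
have mulX (f : n.-tuple T -> R) : posbounded_mfun f -> forall x, f x * f x `^ r = f x `^ (1 + r).
  by move=> pf x; rewrite powR_1D// ltW// pbmf_gt0.
have bY := pbmf_bmf pY; have bh := pbmf_bmf ph.
have b1 := bmfM bh (bP Y r pY); have b2 := bP h (1 + r) ph.
have b3 := bmfM bY (bP h r ph).
(* The tangent to the concave function x^r at h(x) lies above it; the mean of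
   Y h^r equals that of h^{1+r} because h^r ignores the i-th coordinate. *)
have jensen : \int[mu]_x (h x * Y x `^ r) <= \int[mu]_x h x `^ (1 + r).
  have -> : \int[mu]_x h x `^ (1 + r) =
      \int[mu]_x ((1 - r) * h x `^ (1 + r) + r * (Y x * h x `^ r)).
    rewrite integral_bmfD; [|exact: bmfZ|exact: bmfZ].
    rewrite !integral_bmfZ//.
    rewrite -(integral_coord_mean_mulr inv bY (bP h r ph) (indep_powR r ihi)).
    have -> : \int[mu]_x (h x * h x `^ r) = \int[mu]_x h x `^ (1 + r).
      by apply: eq_Rintegral => x _; rewrite mulX.
    by rewrite -mulrDl subrK mul1r.
  apply: le_integral_bmf => //; first by apply: bmfD; exact: bmfZ.
  move=> x; have hx := pbmf_gt0 x ph; have Yx := pbmf_gt0 x pY.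
  have := @powR_concave1 R r (Y x / h x) (ltW r0) r1 (divr_ge0 (ltW Yx) (ltW hx)).
  rewrite -(ler_pM2r (powR_gt0 (1 + r) hx)).
  rewrite {1 3}powR_1D ?(ltW hx) ?(ltW r0)// => H.
  have e : Y x `^ r = (Y x / h x) `^ r * h x `^ r.
    by rewrite -powRM ?divr_ge0 ?(ltW Yx) ?(ltW hx)// divfK ?gt_eqF.
  have {H} := H; rewrite mulrCA -e => /le_trans; apply.
  rewrite le_eqVlt; apply/orP; left; apply/eqP.
  by rewrite -mulX//; field; rewrite gt_eqF.
apply: (@le_trans _ _ (\int[mu]_x (Y x `^ (1 + r) - h x * Y x `^ r))).
  by rewrite (integral_bmfB _ (bP Y (1 + r) pY) b1); exact: lerB (lexx _) jensen.
pose a x x' : R := Y x - Y x'.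
pose b x x' : R := Y x `^ r - Y x' `^ r.
pose M x x' : R := Num.max (a x x') 0 * Num.max (b x x') 0 - a x x' * Y x `^ r.
(* [M] is the difference of the two integrands; it is antisymmetric, so it
   integrates to 0 over two independent resamplings of the same coordinate. *)
have anti x x' : M x x' = - M x' x.
  have mono u v : 0 < u -> u <= v -> u `^ r <= v `^ r.
    by move=> u0 uv; rewrite ge0_ler_powR ?nnegrE ?(ltW r0) ?(ltW u0)// (le_trans (ltW u0)).
  rewrite /M /a /b; have x0 := pbmf_gt0 x pY; have x'0 := pbmf_gt0 x' pY.
  have [xx'|/ltW xx'] := leP (Y x) (Y x').
    have zz := mono _ _ x0 xx'; move: (Y x) (Y x') (Y x `^ r) (Y x' `^ r) zz xx' => y y' z z' zz yy.
    rewrite (max_r (x := y - y')) ?subr_le0// (max_l (x := y' - y)) ?subr_ge0//.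
    by rewrite (max_l (x := z' - z)) ?subr_ge0//; ring.
  have zz := mono _ _ x'0 xx'; move: (Y x) (Y x') (Y x `^ r) (Y x' `^ r) zz xx' => y y' z z' zz yy.
  rewrite (max_r (x := y' - y)) ?subr_le0// (max_l (x := y - y')) ?subr_ge0//.
  by rewrite (max_l (x := z - z')) ?subr_ge0//; ring.
have bM1 d1 (S : measurableType d1) (w w' : S -> n.-tuple T) :
    measurable_fun setT w -> measurable_fun setT w' ->
    bounded_mfun (fun s => Num.max (a (w s) (w' s)) 0 * Num.max (b (w s) (w' s)) 0).
  move=> mw mw'; apply: bmfM; apply: bmf_max0; apply: bmfB.
  - exact: (bmf_comp mw bY).
  - exact: (bmf_comp mw' bY).
  - exact: (bmf_comp mw (bP Y r pY)).
  - exact: (bmf_comp mw' (bP Y r pY)).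
have bM2 d1 (S : measurableType d1) (w w' : S -> n.-tuple T) :
    measurable_fun setT w -> measurable_fun setT w' ->
    bounded_mfun (fun s => a (w s) (w' s) * Y (w s) `^ r).
  move=> mw mw'; apply: bmfM; first apply: bmfB.
  - exact: (bmf_comp mw bY).
  - exact: (bmf_comp mw' bY).
  - exact: (bmf_comp mw (bP Y r pY)).
have bM d1 (S : measurableType d1) (w w' : S -> n.-tuple T) :
    measurable_fun setT w -> measurable_fun setT w' ->
    bounded_mfun (fun s => M (w s) (w' s)).
  by move=> mw mw'; exact: (bmfB (bM1 _ _ _ _ mw mw') (bM2 _ _ _ _ mw mw')).
have mr := @measurable_resample n _ T i.
have mf := @measurable_fst _ _ (n.-tuple T) T.
have mrx x : measurable_fun setT (fun t : T => resample i x t).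
  exact: (measurableT_comp mr (pair1_measurable x)).
have bD := bmf_fubini mu (nu i) (bM _ _ _ _ mf mr).
have D0 : \int[mu]_x \int[nu i]_t M x (resample i x t) = 0.
  rewrite -(integral_coord_mean inv i bD) -[RHS](integral_bmf_cst mu).
  apply: eq_Rintegral => x _; rewrite /coord_mean /=.
  transitivity (\int[nu i]_u \int[nu i]_t M (resample i x u) (resample i x t)).
    apply: eq_Rintegral => u _; apply: eq_Rintegral => t _.
    by rewrite resample_idem.
  have m1 : measurable_fun setT (fun z : T * T => resample i x z.1).
    exact: (measurableT_comp (mrx x) measurable_fst).
  have m2 : measurable_fun setT (fun z : T * T => resample i x z.2).
    exact: (measurableT_comp (mrx x) measurable_snd).
  set I := (LHS).
  have : I = - I.
    rewrite {1}/I (Rfubini_swap (nu i) (nu i) (bM _ _ _ _ m1 m2)) /=.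
    rewrite -[RHS]mulN1r -integral_bmfZ; last exact: (bmf_fubini (nu i) (nu i) (bM _ _ _ _ m1 m2)).
    apply: eq_Rintegral => u _.
    rewrite -integral_bmfZ; last exact: bM.
    by apply: eq_Rintegral => t _; rewrite anti mulN1r.
  by move/eqP; rewrite -addr_eq0 -mulr2n mulrn_eq0/= => /eqP.
rewrite le_eqVlt; apply/orP; left; apply/eqP/esym/eqP.
rewrite -subr_eq0; apply/eqP; rewrite -[RHS]D0.
rewrite -integral_bmfB//; last 2 first.
- exact: (bmf_fubini mu (nu i) (bM1 _ _ _ _ mf mr)).
- by apply: bmfB => //; exact: bP.
apply: eq_Rintegral => x _.
rewrite /M integral_bmfB//; last 2 first.
- exact: bM1.
- exact: bM2.
congr (_ - _).
transitivity (\int[nu i]_t (Y x `^ r * Y x - Y x `^ r * Y (resample i x t))).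
  rewrite integral_bmfB; [|exact: bmf_cst|exact: (bmfZ _ (bmf_comp (mrx x) bY))].
  rewrite integral_bmf_cst integral_bmfZ; last exact: (bmf_comp (mrx x) bY).
  by rewrite -/(coord_mean nu i Y x) -/h -mulX// [h x * _]mulrC [Y x * _]mulrC.
by apply: eq_Rintegral => t _; rewrite /a mulrBl !(mulrC (Y x `^ r)).
Qed.

End tensorization.

(** * The moment inequality *)

Section moment_inequality.
Context {d} {T : measurableType d} {R : realType} {n : nat}.
Variables (mu : probability (n.-tuple T) R) (nu : 'I_n -> probability T R).
Hypothesis inv : resample_invariant mu nu.

Definition drop_energy (q : R) (f : n.-tuple T -> R) (x x' : n.-tuple T) : R :=
  f x `^ (q - 2) * Num.max (f x - f x') 0 ^+ 2.

Lemma bmf_drop_energy (q : R) i f : posbounded_mfun f ->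
  bounded_mfun (fun z : n.-tuple T * T => drop_energy q f z.1 (resample i z.1 z.2)).
Proof.
move=> pf; have mr := @measurable_resample n _ T i.
apply: bmfM; first exact: (bmf_comp measurable_fst (pbmf_bmf (pbmf_powR (q - 2) pf))).
have bm : bounded_mfun (fun z : n.-tuple T * T => Num.max (f z.1 - f (resample i z.1 z.2)) 0).
  apply/bmf_max0/bmfB; first exact: (bmf_comp measurable_fst (pbmf_bmf pf)).
  exact: (bmf_comp mr (pbmf_bmf pf)).
exact: (bmfM bm bm).
Qed.

(** The power entropy of Y = f^{q-1} with r = 1/(q-1): then Y^{1+r} = f^q and
    Y^r = f, and the tangent line of x^{q-1} at f bounds Y - Y' by
    (q - 1) f^{q-2} (f - f'). *)
Lemma moment_inequality (q : R) f : 2 <= q -> posbounded_mfun f ->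
  \int[mu]_x f x `^ q <= (\int[mu]_x f x `^ (q - 1)) `^ (q / (q - 1)) +
   (q - 1) * \sum_(i < n) \int[mu]_x \int[nu i]_t drop_energy q f x (resample i x t).
Proof.
move=> q2 pf; have q10 : 0 < q - 1 by lra.
have q11 : 1 <= q - 1 by lra.
pose r := (q - 1)^-1.
have r0 : 0 < r by rewrite invr_gt0.
have r1 : r <= 1 by rewrite invf_le1.
have r1E : 1 + r = q / (q - 1) by rewrite /r; field; rewrite gt_eqF.
have pY := pbmf_powR (q - 1) pf.
have Yr x : (f x `^ (q - 1)) `^ r = f x.
  by rewrite -powRrM divff ?gt_eqF// powRr1// ltW// pbmf_gt0.
have Yp x : (f x `^ (q - 1)) `^ (1 + r) = f x `^ q.
  by rewrite -powRrM r1E mulrCA divff ?gt_eqF// mulr1.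
have := entropy_tensorization inv r0 r1 pY.
have -> : \int[mu]_x (f x `^ (q - 1)) `^ (1 + r) = \int[mu]_x f x `^ q.
  by apply: eq_Rintegral => x _; rewrite Yp.
rewrite lerBlDl -r1E => /le_trans; apply.
rewrite lerD2l mulr_sumr; apply: ler_sum => i _.
have := entropy_le_covariance inv i r0 r1 pY.
have -> : \int[mu]_x (f x `^ (q - 1)) `^ (1 + r) = \int[mu]_x f x `^ q.
  by apply: eq_Rintegral => x _; rewrite Yp.
move=> h; apply: (le_trans h) => {h}.
have bk := bmf_drop_energy q i pf.
rewrite -integral_bmfZ; last exact: (bmf_fubini mu (nu i) bk).
have mr := @measurable_resample n _ T i.
have bl : bounded_mfun (fun z : n.-tuple T * T =>
    Num.max (f z.1 `^ (q - 1) - f (resample i z.1 z.2) `^ (q - 1)) 0 *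
    Num.max ((f z.1 `^ (q - 1)) `^ r - (f (resample i z.1 z.2) `^ (q - 1)) `^ r) 0).
  apply: bmfM; apply/bmf_max0/bmfB.
  - exact: (bmf_comp measurable_fst (pbmf_bmf pY)).
  - exact: (bmf_comp mr (pbmf_bmf pY)).
  - exact: (bmf_comp measurable_fst (pbmf_bmf (pbmf_powR r pY))).
  - exact: (bmf_comp mr (pbmf_bmf (pbmf_powR r pY))).
apply: le_integral_bmf.
- exact: (bmf_fubini mu (nu i) bl).
- exact/bmfZ/(bmf_fubini mu (nu i) bk).
move=> x; rewrite -integral_bmfZ; last exact: (bmf_sect x bk).
apply: le_integral_bmf.
- exact: (bmf_sect x bl).
- exact/bmfZ/(bmf_sect x bk).
move=> t; rewrite !Yr /drop_energy.
set y := f x; set y' := f _.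
have y0 : 0 < y by exact: pbmf_gt0.
have y'0 : 0 < y' by exact: pbmf_gt0.
have [yy|/ltW yy] := leP y y'.
  rewrite [in leLHS](max_r (x := y - y')) ?subr_le0// mulr0.
  by rewrite mulr_ge0// ?(ltW q10)// mulr_ge0 ?powR_ge0 ?sqr_ge0.
rewrite (max_l (x := y - y')) ?subr_ge0// (max_l (x := _ `^ _ - _)); last first.
  by rewrite subr_ge0 ge0_ler_powR ?nnegrE ?(ltW q10) ?(ltW y0) ?(ltW y'0).
have := powR_tangent q11 (ltW y'0) y0.
have -> : q - 1 - 1 = q - 2 by lra.
move=> h; rewrite expr2 !mulrA; apply: ler_wpM2r; first by rewrite subr_ge0.
lra.
Qed.

End moment_inequality.

(** * The constants kappa_q and the recursion they solve *)

Section kappa_bounds.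
Variable R : realType.
Implicit Types s t : R.

(** Bernoulli's inequality (1 - 1/s)^{s/t} <= 1 - 1/t, raised to the power
    t/2. *)
Lemma one_minus_inv_powR_incr s t : 2 <= s -> s <= t ->
  (1 - s^-1) `^ (s / 2) <= (1 - t^-1) `^ (t / 2).
Proof.
move=> s2 st; have s0 : 0 < s by lra.
have t0 : 0 < t by lra.
have is1 : s^-1 <= 1 by rewrite invf_le1//; lra.
have it1 : t^-1 <= 1 by rewrite invf_le1//; lra.
have h : (1 - s^-1) `^ (s / t) <= 1 - t^-1.
  have := @powR_concave1 R (s / t) (1 - s^-1).
  rewrite divr_ge0 ?(ltW s0) ?(ltW t0)// ler_pdivrMr// mul1r subr_ge0.
  move=> /(_ isT st is1) /le_trans; apply.
  rewrite le_eqVlt; apply/orP; left; apply/eqP.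
  by field; rewrite !gt_eqF.
have -> : s / 2 = (s / t) * (t / 2) by field; rewrite gt_eqF.
rewrite powRrM ge0_ler_powR ?nnegrE ?powR_ge0//; lra.
Qed.

Lemma one_minus_inv_powR_le_exp t : 2 <= t ->
  (1 - t^-1) `^ (t / 2) <= expR (- 2^-1).
Proof.
move=> t2; have t0 : 0 < t by lra.
have it1 : t^-1 <= 1 by rewrite invf_le1//; lra.
have h : 1 - t^-1 <= expR (- t^-1) by have := expR_ge1Dx (- t^-1); lra.
apply: (@le_trans _ _ (expR (- t^-1) `^ (t / 2))).
  by rewrite ge0_ler_powR ?nnegrE ?expR_ge0//; lra.
rewrite -expRM le_eqVlt; apply/orP; left; apply/eqP; congr expR.
by field; rewrite gt_eqF.
Qed.

Lemma one_minus_inv_powR_lt1 t : 2 <= t -> (1 - t^-1) `^ (t / 2) < 1.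
Proof.
move=> t2; apply: le_lt_trans (one_minus_inv_powR_le_exp t2) _.
by rewrite expR_lt1 oppr_lt0 invr_gt0.
Qed.

Lemma kappa_incr s t : 2 <= s -> s <= t -> kappa_ s <= kappa_ t.
Proof.
move=> s2 st; have t2 := le_trans s2 st; rewrite /kappa_ ler_pM2l//.
rewrite lef_pV2 ?posrE ?subr_gt0 ?one_minus_inv_powR_lt1//.
by rewrite lerD2l lerN2 one_minus_inv_powR_incr.
Qed.

Lemma kappa_ge1 t : 2 <= t -> 1 <= kappa_ t.
Proof.
move=> t2; apply: le_trans (kappa_incr (lexx _) t2).
rewrite /kappa_ divff// powRr1; last by rewrite subr_ge0 invf_le1//; lra.
by rewrite le_eqVlt; apply/orP; left; apply/eqP; field.
Qed.

(** The value of kappa_q with (1 - 1/q)^{q/2} replaced by its limit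
    e^{-1/2}. *)
Lemma kappaE : kappa = 2^-1 * (1 - expR (- 2^-1))^-1 :> R.
Proof.
have e2 : Num.sqrt (expR 1) = expR 2^-1 :> R.
  by rewrite -powR12_sqrt ?expR_ge0// -expRM mul1r.
rewrite /kappa e2 expRN.
have : 1 < expR 2^-1 :> R by rewrite expR_gt1 invr_gt0.
by move: (expR _) => E E1; field; rewrite !gt_eqF//; lra.
Qed.

Lemma kappa_le_kappa t : 2 <= t -> kappa_ t <= kappa.
Proof.
move=> t2; rewrite kappaE /kappa_ ler_pM2l//.
rewrite lef_pV2 ?posrE ?subr_gt0 ?one_minus_inv_powR_lt1//.
by rewrite lerD2l lerN2 one_minus_inv_powR_le_exp.
Qed.

(** Put th = (1 - 1/s)^{s/2} and K = 2 kappa_s (s - 1) c.  The definition of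
    kappa_s says that (s - 1) c = (1 - th) K, while U^{s/2} <= th K^{s/2}.  If
    M were larger than K^{s/2}, then th K^{s/2} < th M and K < M^{2/s}, so the
    assumed bound on M would give M < th M + (1 - th) M. *)
Lemma moment_recursion s (c U M : R) : 2 <= s -> 0 < c -> 0 <= U -> 0 <= M ->
  U <= (1 - s^-1) * (2 * kappa_ s * (s - 1) * c) ->
  M <= U `^ (s / 2) + (s - 1) * c * M `^ (1 - 2 / s) ->
  M <= (2 * kappa_ s * (s - 1) * c) `^ (s / 2).
Proof.
move=> s2 c0 U0 M0; move KE : (2 * kappa_ s * (s - 1) * c) => K UK HM.
have k1 := kappa_ge1 s2.
have s0 : 0 < s by lra.
have k0 : 0 < kappa_ s by exact: lt_le_trans k1.
have s10 : 0 < s - 1 by lra.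
have K0 : 0 < K by rewrite -KE; apply: mulr_gt0 c0; apply: mulr_gt0 s10; exact: mulr_gt0.
have is1 : s^-1 <= 1 by rewrite invf_le1//; lra.
have t0 : 0 <= 1 - s^-1 by lra.
have p0 : 0 < s / 2 by lra.
pose th := (1 - s^-1) `^ (s / 2).
have th0 : 0 < th.
  by rewrite powR_gt0 ?subr_gt0 ?invf_lt1//; lra.
have th1 : th < 1 by exact: one_minus_inv_powR_lt1.
have cK : (s - 1) * c = (1 - th) * K.
  rewrite -KE /kappa_ -/th; field; rewrite gt_eqF//; lra.
have UK' : U `^ (s / 2) <= th * K `^ (s / 2).
  rewrite -powRM ?(ltW K0)//.
  by rewrite ge0_ler_powR ?nnegrE ?(ltW p0)// mulr_ge0// ltW.
rewrite leNgt; apply/negP => KM.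
have Mgt : 0 < M by apply: le_lt_trans KM; exact: powR_ge0.
have KM' : K <= M `^ (2 / s).
  have -> : K = (K `^ (s / 2)) `^ (2 / s).
    rewrite -powRrM (_ : s / 2 * (2 / s) = 1) ?powRr1 ?(ltW K0)//.
    by field; rewrite gt_eqF.
  rewrite ge0_ler_powR ?nnegrE ?powR_ge0 ?(ltW KM) ?(ltW Mgt)//.
  by rewrite divr_ge0// ltW.
have MM : K * M `^ (1 - 2 / s) <= M.
  apply: (@le_trans _ _ (M `^ (2 / s) * M `^ (1 - 2 / s))).
    by rewrite ler_wpM2r// powR_ge0.
  rewrite -powRD; last by apply/implyP => _; exact: lt0r_neq0.
  by rewrite addrCA subrr addr0 powRr1// ltW.
have : M <= th * K `^ (s / 2) + (1 - th) * M.
  apply: le_trans HM _; apply: lerD => //.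
  by rewrite cK -mulrA ler_wpM2l// subr_ge0 ltW.
have : th * K `^ (s / 2) < th * M by rewrite ltr_pM2l.
lra.
Qed.

End kappa_bounds.

(** * Joint law of independent variables and of a resampled copy *)

Lemma measurable_joint (n : nat) d d' (Omega : measurableType d)
    (T : measurableType d') (X : 'I_n -> {mfun Omega >-> T}) :
  measurable_fun [set: Omega] (joint X).
Proof.
apply/measurable_fun_tnthP => j.
rewrite (_ : _ \o _ = X j); first exact: measurable_funPT.
by apply/funext => w /=; rewrite tnth_mktuple.
Qed.

HB.instance Definition _ (n : nat) d d' (Omega : measurableType d)
    (T : measurableType d') (X : 'I_n -> {mfun Omega >-> T}) :=
  isMeasurableFun.Build _ _ _ _ (joint X) (measurable_joint X).

Definition box {n : nat} {T : Type} (B : 'I_n -> set T) : set (n.-tuple T) :=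
  [set x | forall i, B i (tnth x i)].

(** A pi-system generating the product sigma-algebra and on which independence
    determines the joint law. *)
Definition boxes (n : nat) d (T : measurableType d) : set (set (n.-tuple T)) :=
  [set A | exists2 B : 'I_n -> set T, (forall i, measurable (B i)) & A = box B].

Lemma measurable_boxes (n : nat) d (T : measurableType d) :
  @measurable _ (n.-tuple T) = <<s @boxes n _ T >>.
Proof.
rewrite eqEsubset; split.
  apply: smallest_sub; first exact: smallest_sigma_algebra.
  rewrite -bigcup_seq/= => _ [i _ [B mB <-]]; apply: sub_sigma_algebra.
  exists (fun j => if j == i then B else setT).
    by move=> j; case: ifP.
  rewrite setTI; apply/seteqP; split => x /=.
    by move=> Bx j; case: eqP => [->|].
  by move/(_ i); rewrite eqxx.
apply: smallest_sub; first exact: sigma_algebra_measurable.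
move=> _ [B mB ->].
rewrite (_ : box B = \bigcap_(i in setT) ((@tnth n T ^~ i) @^-1` B i)); last first.
  by apply/seteqP; split => x /= h i; [move=> _|]; exact: h.
apply: fin_bigcap_measurable; first exact: finite_finset.
by move=> i _; rewrite -[X in measurable X]setTI; exact: measurable_tnth.
Qed.

Section laws.
Context {R : realType} {d d' : measure_display} {Omega : measurableType d}
  {T : measurableType d'}.
Variables (P : probability Omega R) (n : nat) (X X' : 'I_n -> {mfun Omega >-> T}).
Hypothesis hX : mutually_independent P (fun i => X i : Omega -> T).
Hypothesis hX' : independent_copy P (joint X) (joint X').

Definition law_joint : probability (n.-tuple T) R := distribution P (joint X).
Definition law_coord (i : 'I_n) : probability T R := distribution P (X i).

Lemma law_joint_box B : (forall i, measurable (B i)) ->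
  law_joint (box B) = (\prod_(i < n) P (X i @^-1` B i))%E.
Proof.
move=> mB; have := hX (J := [set: 'I_n]%SET) (B := B) (fun i _ => mB i).
rewrite (_ : \bigcap_(i in _) _ = joint X @^-1` box B); last first.
  apply/seteqP; split => w /= h i; first by rewrite tnth_mktuple; apply: h; rewrite /= inE.
  by move=> _; have := h i; rewrite tnth_mktuple.
move=> h; transitivity (P (joint X @^-1` box B)); first by [].
by rewrite h; apply: eq_bigl => i; rewrite inE.
Qed.

(** Both laws give a box the product of its marginal probabilities, and boxes
    determine a measure. *)
Lemma resample_invariant_law : resample_invariant law_joint law_coord.
Proof.
move=> i A mA.
pose phi : {mfun (n.-tuple T * T)%type >-> n.-tuple T} := HB.pack
  (fun z : n.-tuple T * T => resample i z.1 z.2)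
  (isMeasurableFun.Build _ _ _ _ _ (@measurable_resample n _ T i)).
pose m2 : {measure set (n.-tuple T) -> \bar R} :=
  distribution (law_joint \x law_coord i)%E phi.
rewrite -[LHS]/(m2 A); apply/esym.
apply: (measure_unique (@boxes n _ T) (fun=> setT)) => //.
- exact: measurable_boxes.
- move=> _ _ [B mB ->] [C mC ->]; exists (fun i => B i `&` C i).
    by move=> j; exact: measurableI.
  apply/seteqP; split => x /=.
    by move=> [Bx Cx] j; split; [exact: Bx | exact: Cx].
  by move=> h; split => j; have [] := h j.
- by move=> _; exists (fun=> setT) => //; apply/seteqP; split => x.
- by rewrite bigcup_const//; exists 0.
- move=> _ [B mB ->].
  pose B' j := if j == i then setT else B j.
  have mB' j : measurable (B' j) by rewrite /B'; case: ifP.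
  rewrite /m2 /distribution /pushforward /=.
  rewrite (_ : _ @^-1` _ = box B' `*` B i); last first.
    apply/seteqP; split => [[x t]|[x t]] /=.
      move=> h; split; last by have := h i; rewrite tnth_mktuple eqxx.
      by move=> j; rewrite /B'; have := h j; rewrite tnth_mktuple; case: eqP.
    move=> [h Bt] j; rewrite tnth_mktuple; case: eqP => [->//|/eqP ji].
    by have := h j; rewrite /B' (negbTE ji).
  have mbox : measurable (box B').
    by rewrite measurable_boxes; apply: sub_sigma_algebra; exists B'.
  rewrite product_measure1E//.
  rewrite [X in _ = (X * _)%E](law_joint_box mB') law_joint_box//.
  rewrite (bigD1 i)//= [in RHS](bigD1 i)//= {1}/B' eqxx preimage_setT probability_setT mul1e muleC.
  congr (_ * _)%E; apply: eq_bigr => j ji.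
  by rewrite /B' (negbTE ji).
- by move=> _; rewrite (le_lt_trans (probability_le1 _ _))// ltry.
Qed.

(** The copy [X'] is independent of [X] and its i-th coordinate has the law of
    [X i], so integrals over the product of [law_joint] and [law_coord i] are
    expectations on [Omega]. *)
Lemma law_pair i (A : set (n.-tuple T * T)) : measurable A ->
  (law_joint \x law_coord i)%E A = P ((fun w => (joint X w, X' i w)) @^-1` A).
Proof.
have mpair : measurable_fun setT (fun w => (joint X w, X' i w)).
  by apply: measurable_fun_pair => //; exact: measurable_joint.
pose h : {mfun Omega >-> (n.-tuple T * T)%type} :=
  HB.pack (fun w => (joint X w, X' i w)) (isMeasurableFun.Build _ _ _ _ _ mpair).
move=> mA; apply: (@product_measure_unique _ _ _ _ _
  law_joint (law_coord i) (distribution P h)) => // B C mB mC.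
rewrite /distribution /pushforward /=.
have mD : measurable ((@tnth n T ^~ i) @^-1` C).
  by rewrite -[X in measurable X]setTI; exact: measurable_tnth.
have [same indep] := hX'.
have := indep _ _ mB mD.
rewrite (same _ mD).
have tE (W : 'I_n -> {mfun Omega >-> T}) : joint W @^-1` ((@tnth n T ^~ i) @^-1` C) = W i @^-1` C.
  by apply/seteqP; split => w /=; rewrite tnth_mktuple.
by rewrite !tE.
Qed.

Lemma integral_law_joint (g : n.-tuple T -> \bar R) :
  measurable_fun setT g -> (forall x, 0 <= g x)%E ->
  (\int[law_joint]_x g x = \int[P]_w g (joint X w))%E.
Proof.
move=> mg g0.
have := @ge0_integral_pushforward _ _ _ _ _ _ (measurable_joint X) P setT g measurableT mg.
by rewrite preimage_setT => <-.
Qed.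

Lemma integral_law_pair i (g : n.-tuple T * T -> \bar R) :
  measurable_fun setT g -> (forall x, 0 <= g x)%E ->
  (\int[(law_joint \x law_coord i)]_x g x = \int[P]_w g (joint X w, X' i w))%E.
Proof.
move=> mg g0.
have mpair : measurable_fun setT (fun w => (joint X w, X' i w)).
  by apply: measurable_fun_pair => //; exact: measurable_joint.
have := @ge0_integral_pushforward _ _ _ _ _ _ mpair P setT g measurableT mg.
rewrite preimage_setT => <-//.
by apply: eq_measure_integral => A mA _; exact: law_pair.
Qed.

End laws.

(** * Conditional expectations against nonnegative weights *)

Section weighted_conditional_expectation.
Context {R : realType} {d d' : measure_display} {Omega : measurableType d}
  {S : measurableType d'}.
Variables (P : probability Omega R) (W : Omega -> S).
Hypothesis mW : measurable_fun setT W.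
Implicit Types (U Y V : Omega -> \bar R) (H : S -> R).

(** H = int 1_{0 <= t < H} dt, and Tonelli's theorem. *)
Lemma layer_cake U H : (forall w, 0 <= U w)%E -> measurable_fun setT U ->
  (forall s, 0 <= H s) -> measurable_fun setT H ->
  (\int[P]_w ((H (W w))%:E * U w) =
   \int[lebesgue_measure]_t \int[P]_(w in W @^-1` [set s | (0 <= t < H s)%R]) U w)%E.
Proof.
move=> U0 mU H0 mH.
pose K (z : Omega * R) : \bar R := (U z.1 * (\1_[set z : Omega * R | 0 <= z.2 < H (W z.1)] z)%:E)%E.
have mHW : measurable_fun setT (fun z : Omega * R => H (W z.1)).
  exact/(measurableT_comp mH)/(measurableT_comp mW).
have mA : measurable [set z : Omega * R | 0 <= z.2 < H (W z.1)].
  have mb : measurable_fun setT (fun z : Omega * R => (0 <= z.2) && (z.2 < H (W z.1))).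
    apply: measurable_and; first exact: measurable_fun_ler.
    exact: measurable_fun_ltr.
  by have := mb measurableT [set true] I; rewrite setTI.
have mI : measurable_fun setT (fun z : Omega * R =>
    (\1_[set z : Omega * R | 0 <= z.2 < H (W z.1)] z)%:E : \bar R).
  by apply/measurable_EFinP; exact: measurable_indic.
have mK : measurable_fun setT K.
  by apply: emeasurable_funM => //; exact: (measurableT_comp mU measurable_fst).
have K0 z : (0 <= K z)%E by rewrite mule_ge0// lee_fin.
transitivity (\int[P]_w \int[lebesgue_measure]_t K (w, t))%E.
  apply: eq_integral => w _; rewrite /K /= ge0_integralZl//; last first.
    exact: (measurableT_comp mI (pair1_measurable w)).
  rewrite muleC; congr (_ * _)%E.
  rewrite (_ : (fun t : R => _) = fun t => (\1_(`[0, H (W w)[%classic) t)%:E); last first.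
    apply/funext => t; rewrite !indicE.
    suff -> : ((w, t) \in [set z : Omega * R | 0 <= z.2 < H (W z.1)]) =
      (t \in `[0, H (W w)[%classic) by [].
    by apply/idP/idP; rewrite !inE /= ?in_itv.
  rewrite integral_indic// setIT /= lebesgue_measure_itv/= lte_fin sube0.
  have := H0 (W w); rewrite le_eqVlt => /predU1P[<-|->//].
  by rewrite ltxx.
transitivity (\int[lebesgue_measure]_t \int[P]_w K (w, t))%E.
  exact: (@fubini_tonelli _ _ _ _ _ P lebesgue_measure K mK K0).
apply: eq_integral => t _.
rewrite [RHS]integral_mkcond; apply: eq_integral => w _.
rewrite /K /= indicE patchE.
have -> : ((w, t) \in [set z : Omega * R | 0 <= z.2 < H (W z.1)]) =
  (w \in W @^-1` [set s | 0 <= t < H s]) by apply/idP/idP; rewrite !inE.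
by case: ifP => _; rewrite ?mule1 ?mule0.
Qed.

Lemma cond_expectation_measurable Y V :
  is_nonneg_cond_expectation P (sigma_of W) Y V -> measurable_fun setT V.
Proof.
move=> [_ mV _] _ B mB; rewrite setTI; have [C mC <-] := mV B mB.
exact: mW.
Qed.

(** The defining property of a conditional expectation concerns events only;
        layers of H reduce nonnegative weights to events, even where [V] is
    infinite. *)
Lemma cond_expectation_weighted Y V H :
  (forall w, 0 <= Y w)%E -> measurable_fun setT Y ->
  (forall s, 0 <= H s) -> measurable_fun setT H ->
  is_nonneg_cond_expectation P (sigma_of W) Y V ->
  (\int[P]_w ((H (W w))%:E * Y w) = \int[P]_w ((H (W w))%:E * V w))%E.
Proof.
move=> Y0 mY H0 mH cV; have mV := cond_expectation_measurable cV.
have [V0 _ VY] := cV.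
rewrite !layer_cake//; apply: eq_integral => t _; apply/esym/VY.
exists [set s | 0 <= t < H s]; last by rewrite setTI.
have mb : measurable_fun setT (fun s => (0 <= t) && (t < H s)).
  apply: measurable_and; first exact: measurable_cst.
  exact: measurable_fun_ltr.
by have := mb measurableT [set true] I; rewrite setTI.
Qed.

End weighted_conditional_expectation.

(** * The moment inequality in terms of a norm of V *)

Lemma powR_amgm (R : realType) (t x u : R) : 0 <= t -> t <= 1 -> 0 <= x -> 0 < u ->
  x `^ t * u `^ (1 - t) <= t * x + (1 - t) * u.
Proof.
move=> t0 t1 x0 u0.
have := powR_concave1 t0 t1 (divr_ge0 x0 (ltW u0)).
rewrite -(ler_pM2r u0).
have -> : (1 - t + t * (x / u)) * u = t * x + (1 - t) * u.
  by field; rewrite gt_eqF.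
apply: le_trans; rewrite le_eqVlt; apply/orP; left; apply/eqP.
have -> : x `^ t = (x / u) `^ t * u `^ t.
  by rewrite -powRM ?divr_ge0 ?(ltW u0)// divfK ?gt_eqF.
rewrite -mulrA -powRD; last by apply/implyP => _; exact: lt0r_neq0.
by rewrite addrC subrK powRr1// ltW.
Qed.

(** The arithmetic-geometric inequality with weights 2/s and 1 - 2/s for
    (v/c)^{s/2} and phi^s/Phi, followed by the concavity of x^{s/q}, which
    replaces the exponent s/2 of v/c by q/2: so one bound on the L^{q/2} norm of
    V serves for all s <= q.  The right side is affine in v^{q/2} and phi^s,
    which are the quantities with a known mean. *)
Lemma young_moment (R : realType) (q s c Phi v phi : R) :
  2 <= s -> s <= q -> 0 < c -> 0 < Phi -> 0 <= v -> 0 < phi ->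
  phi `^ (s - 2) * v <= c * Phi `^ (1 - 2 / s) * (2 / s * (1 - s / q))
    + c * Phi `^ (1 - 2 / s) * (2 / q / c `^ (q / 2)) * v `^ (q / 2)
    + c * Phi `^ (1 - 2 / s) * ((1 - 2 / s) / Phi) * phi `^ s.
Proof.
move=> s2 sq c0 Phi0 v0 phi0.
have s0 : 0 < s by lra.
have q0 : 0 < q by lra.
have t0 : 0 <= 2 / s by rewrite divr_ge0// ltW.
have t1 : 2 / s <= 1 by rewrite ler_pdivrMr// mul1r.
have r0 : 0 <= s / q by rewrite divr_ge0// ltW.
have r1 : s / q <= 1 by rewrite ler_pdivrMr// mul1r.
have vc0 : 0 <= v / c by rewrite divr_ge0// ltW.
have u0 : 0 < phi `^ s / Phi by rewrite divr_gt0// powR_gt0.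
have h1 := powR_amgm t0 t1 (powR_ge0 (v / c) (s / 2)) u0.
have h2 := powR_concave1 r0 r1 (powR_ge0 (v / c) (q / 2)).
have e1 : ((v / c) `^ (s / 2)) `^ (2 / s) = v / c.
  rewrite -powRrM (_ : s / 2 * (2 / s) = 1) ?powRr1//.
  by field; rewrite gt_eqF.
have e2 : ((v / c) `^ (q / 2)) `^ (s / q) = (v / c) `^ (s / 2).
  by rewrite -powRrM; congr (_ `^ _); field; rewrite gt_eqF.
have e3 : (phi `^ s / Phi) `^ (1 - 2 / s) = phi `^ (s - 2) / Phi `^ (1 - 2 / s).
  rewrite powRM ?powR_ge0 ?invr_ge0 ?(ltW Phi0)//; congr (_ * _).
    by rewrite -powRrM; congr (_ `^ _); field; rewrite gt_eqF.
  by rewrite -[Phi^-1]powR_inv1 ?(ltW Phi0)// -powRrM mulN1r powRN.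
have e4 : (v / c) `^ (q / 2) = v `^ (q / 2) / c `^ (q / 2).
  rewrite powRM ?invr_ge0 ?(ltW c0)//; congr (_ * _).
  by rewrite -[c^-1]powR_inv1 ?(ltW c0)// -powRrM mulN1r powRN.
rewrite e1 e3 in h1; rewrite e2 e4 in h2.
have D0 : 0 < c * Phi `^ (1 - 2 / s) by rewrite mulr_gt0// powR_gt0.
have h3 : v / c * (phi `^ (s - 2) / Phi `^ (1 - 2 / s)) <=
   2 / s * (1 - s / q + s / q * (v `^ (q / 2) / c `^ (q / 2)))
   + (1 - 2 / s) * (phi `^ s / Phi).
  by apply: le_trans h1 _; rewrite lerD2r ler_wpM2l.
have {h1 h2} := h3; rewrite -(ler_pM2l D0).
have P0 : Phi `^ (1 - 2 / s) != 0 by rewrite gt_eqF// powR_gt0.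
have C0 : c `^ (q / 2) != 0 by rewrite gt_eqF// powR_gt0.
have -> : c * Phi `^ (1 - 2 / s) * (v / c * (phi `^ (s - 2) / Phi `^ (1 - 2 / s))) =
  phi `^ (s - 2) * v by field; rewrite P0 gt_eqF.
move=> /le_trans; apply; rewrite le_eqVlt; apply/orP; left; apply/eqP.
by field; rewrite C0 !gt_eqF.
Qed.

Lemma measurable_joint_resample (n : nat) d d' (Omega : measurableType d)
    (T : measurableType d') (X X' : 'I_n -> {mfun Omega >-> T}) i :
  measurable_fun [set: Omega] (joint_resample X X' i).
Proof.
apply/measurable_fun_tnthP => j.
rewrite (_ : _ \o _ = if j == i then X' j else X j :> (Omega -> T)); last first.
  by apply/funext => w /=; rewrite tnth_mktuple; case: ifP.
by case: ifP => _; exact: measurable_funPT.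
Qed.

Lemma resample_joint (n : nat) (Omega T : Type) (X X' : 'I_n -> Omega -> T) i w :
  resample i (joint X w) (X' i w) = joint_resample X X' i w.
Proof.
apply: eq_from_tnth => j; rewrite !tnth_mktuple.
by case: eqP => [->|].
Qed.

Section moments_on_the_sample_space.
Context {R : realType} {d d' : measure_display} {Omega : measurableType d}
  {T : measurableType d'}.
Variables (P : probability Omega R) (n : nat) (X X' : 'I_n -> {mfun Omega >-> T}).
Hypothesis hX : mutually_independent P (fun i => X i : Omega -> T).
Hypothesis hX' : independent_copy P (joint X) (joint X').
Variables (F : n.-tuple T -> R) (V : Omega -> \bar R).
Hypothesis mF : measurable_fun setT F.

Let Y w : \bar R := (\sum_(i < n)
  pos_part (F (joint X w) - F (joint_resample X X' i w)) ^+ 2)%:E.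

Hypothesis hV : is_nonneg_cond_expectation P (sigma_of (joint X)) Y V.

Let mu := law_joint P X.
Let nu := law_coord P X.

(** This holds when [f] is a nondecreasing 1-Lipschitz function of [G]. *)
Definition contraction_of (G f : n.-tuple T -> R) := forall x x',
  Num.max (f x - f x') 0 <= Num.max (G x - G x') 0.

Let rj i w : resample i (joint X w) (X' i w) = joint_resample X X' i w.
Proof. exact: (resample_joint X X'). Qed.

(** Drops of [f] are at most drops of [F], and the weight f^{q-2} depends on X
    only, so the squared drops of [F] may be replaced by their conditional
    expectation [V]. *)
Lemma sum_drop_energy_le q f : posbounded_mfun f -> contraction_of F f ->
  ((\sum_(i < n) \int[mu]_x \int[nu i]_t drop_energy q f x (resample i x t))%:E
   <= \int[P]_w ((f (joint X w) `^ (q - 2))%:E * V w))%E.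
Proof.
move=> pf cf.
have mjr i := measurable_joint_resample X X' i.
have mj := measurable_joint X.
have mY : measurable_fun setT Y.
  apply/measurable_EFinP; apply: measurable_sum => i.
  apply: measurable_funX; apply: measurable_maxr => //.
  apply: measurable_funB; first exact: (measurableT_comp mF mj).
  exact: (measurableT_comp mF (mjr i)).
have Y0 w : (0 <= Y w)%E by rewrite lee_fin sumr_ge0// => i _; exact: sqr_ge0.
have mfq : measurable_fun setT (fun x => f x `^ (q - 2)) by case: (pbmf_powR (q - 2) pf).
rewrite -(cond_expectation_weighted mj Y0 mY _ mfq hV); last by move=> x; exact: powR_ge0.
have E0 i z : 0 <= drop_energy q f z.1 (resample i z.1 z.2).
  by rewrite mulr_ge0 ?powR_ge0 ?sqr_ge0.
have mE i : measurable_fun setT (fun z : n.-tuple T * T =>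
    (drop_energy q f z.1 (resample i z.1 z.2))%:E).
  by apply/measurable_EFinP; case: (bmf_drop_energy q i pf).
have mpair i : measurable_fun setT (fun w => (joint X w, X' i w)).
  by apply: measurable_fun_pair => //; exact: measurable_joint.
have -> : ((\sum_(i < n) \int[mu]_x \int[nu i]_t drop_energy q f x (resample i x t))%:E
   = \int[P]_w \sum_(i < n) (drop_energy q f (joint X w) (joint_resample X X' i w))%:E)%E.
  rewrite ge0_integral_sum//; last 2 first.
  - move=> i; rewrite (_ : (fun _ => _) = (fun z : n.-tuple T * T =>
      (drop_energy q f z.1 (resample i z.1 z.2))%:E) \o (fun w => (joint X w, X' i w))).
      exact: (measurableT_comp (mE i) (mpair i)).
    by apply/funext => w /=; rewrite rj.
  - by move=> i w _; rewrite lee_fin -rj; exact: (E0 i (joint X w, X' i w)).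
  rewrite -sumEFin; apply: eq_bigr => i _.
  have bk := bmf_drop_energy q i pf.
  rewrite (Rfubini mu (nu i) bk) -(bmf_integralE _ bk).
  rewrite (integral_law_pair hX' i (mE i)); last by move=> z; rewrite lee_fin.
  by apply: eq_integral => w _ /=; rewrite rj.
apply: ge0_le_integral => //.
- by move=> w _; apply: sume_ge0 => i _; rewrite lee_fin -rj; exact: (E0 i (joint X w, X' i w)).
- apply: emeasurable_sum => i.
  rewrite (_ : (fun _ => _) = (fun z : n.-tuple T * T =>
      (drop_energy q f z.1 (resample i z.1 z.2))%:E) \o (fun w => (joint X w, X' i w))).
    exact: (measurableT_comp (mE i) (mpair i)).
  by apply/funext => w /=; rewrite rj.
- apply: emeasurable_funM => //; apply/measurable_EFinP.
  exact: (measurableT_comp mfq mj).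
move=> w _; rewrite sumEFin /Y -EFinM lee_fin mulr_sumr; apply: ler_sum => i _.
rewrite /drop_energy /pos_part ler_wpM2l ?powR_ge0// lerXn2r ?nnegrE ?le_max ?lexx ?orbT//.
by rewrite -le_max; exact: cf.
Qed.

Variables (q c : R).
Hypothesis c0 : 0 < c.
Hypothesis Vc : (\int[P]_w (V w `^ (q / 2)) <= (c `^ (q / 2))%:E)%E.

(** Holder's inequality for V and f^{s-2}, obtained by integrating
    [young_moment], where Phi is the s-th moment of f.  The pointwise bound is
    also true where V is infinite. *)
Lemma integral_weighted_le s f : 2 <= s -> s <= q -> posbounded_mfun f ->
  (\int[P]_w ((f (joint X w) `^ (s - 2))%:E * V w)
   <= (c * (\int[mu]_x f x `^ s) `^ (1 - 2 / s))%:E)%E.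
Proof.
move=> s2 sq pf.
have mj := measurable_joint X.
have [V0 _ _] := hV.
have mV := cond_expectation_measurable mj hV.
have [mf _] := pf.
have mfX : measurable_fun setT (fun w => f (joint X w)) := measurableT_comp mf mj.
have mfXp t : measurable_fun setT (fun w => (f (joint X w) `^ t)%:E).
  apply/measurable_EFinP.
  exact: (@measurableT_comp _ _ _ _ _ _ (@powR R ^~ t) _ (fun w => f (joint X w))).
have mVq : measurable_fun setT (fun w => (V w `^ (q / 2))%E).
  exact: (measurableT_comp (measurable_poweR _) mV).
have bfs := pbmf_bmf (pbmf_powR s pf).
set Phi := \int[mu]_x f x `^ s.
have Phi0 : 0 < Phi.
  have [_ [e [M [e0 h]]]] := pbmf_powR s pf.
  apply: lt_le_trans e0 _; rewrite -[leLHS](integral_bmf_cst mu).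
  apply: le_integral_bmf => //; first exact: bmf_cst.
  by move=> x; have /andP[] := h x.
have PhiE : (\int[P]_w (f (joint X w) `^ s)%:E = Phi%:E)%E.
  rewrite /Phi -(bmf_integralE _ bfs) integral_law_joint//.
    by apply/measurable_EFinP; case: bfs.
  by move=> x; rewrite lee_fin powR_ge0.
have s0 : 0 < s by lra.
have q0 : 0 < q by lra.
pose a := c * Phi `^ (1 - 2 / s) * (2 / s * (1 - s / q)).
pose b := c * Phi `^ (1 - 2 / s) * (2 / q / c `^ (q / 2)).
pose k := c * Phi `^ (1 - 2 / s) * ((1 - 2 / s) / Phi).
have t1 : 2 / s <= 1 by rewrite ler_pdivrMr// mul1r.
have r1 : s / q <= 1 by rewrite ler_pdivrMr// mul1r.
have D0 : 0 < c * Phi `^ (1 - 2 / s) by rewrite mulr_gt0// powR_gt0.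
have a0 : 0 <= a.
  by rewrite mulr_ge0 ?(ltW D0)// mulr_ge0 ?divr_ge0 ?(ltW s0)// subr_ge0.
have b0 : 0 < b by rewrite mulr_gt0// !divr_gt0// powR_gt0.
have k0 : 0 <= k by rewrite mulr_ge0 ?(ltW D0)// divr_ge0 ?(ltW Phi0)// subr_ge0.
apply: (@le_trans _ _ (\int[P]_w (a%:E + b%:E * (V w `^ (q / 2))
    + k%:E * (f (joint X w) `^ s)%:E))%E).
  apply: ge0_le_integral => //.
  - by move=> w _; rewrite mule_ge0// lee_fin powR_ge0.
  - exact: emeasurable_funM.
  - apply: emeasurable_funD; last exact: measurable_funeM.
    by apply: emeasurable_funD => //; exact: measurable_funeM.
  move=> w _; have := V0 w; have fw := pbmf_gt0 (joint X w) pf.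
  case: (V w) => [v||//] => v0.
    rewrite lee_fin in v0.
    by rewrite poweR_EFin -!EFinM -!EFinD lee_fin; exact: young_moment.
  rewrite poweRyr ?gt_eqF ?divr_gt0// [leRHS](_ : _ = +oo%E) ?leey//.
  by rewrite gt0_muley ?lte_fin// addey// addye// -EFinM.
rewrite ge0_integralD//; last 4 first.
- by move=> w _; rewrite adde_ge0 ?mule_ge0 ?lee_fin ?(ltW b0) ?poweR_ge0.
- by apply: emeasurable_funD => //; exact: measurable_funeM.
- by move=> w _; rewrite mule_ge0 ?lee_fin ?powR_ge0.
- exact: measurable_funeM.
rewrite ge0_integralD//; last 2 first.
- by move=> w _; rewrite mule_ge0 ?lee_fin ?(ltW b0) ?poweR_ge0.
- exact: measurable_funeM.
rewrite ge0_integralZl//; last 2 first.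
- by move=> w _; exact: poweR_ge0.
- by rewrite lee_fin ltW.
rewrite ge0_integralZl//; last first.
- by move=> w _; rewrite lee_fin powR_ge0.
have Pa : (\int[P]_w a%:E = a%:E)%E.
  rewrite integral_cst// -[RHS]mule1; congr (_ * _)%E; exact: probability_setT.
rewrite PhiE Pa.
apply: (@le_trans _ _ (a%:E + b%:E * (c `^ (q / 2))%:E + k%:E * Phi%:E)%E).
  by rewrite leeD2r// leeD2l// lee_pmul2l.
rewrite -!EFinM -!EFinD lee_fin le_eqVlt; apply/orP; left; apply/eqP.
have C0 : c `^ (q / 2) != 0 by rewrite gt_eqF// powR_gt0.
by rewrite /a /b /k; field; rewrite C0 !gt_eqF.
Qed.

Lemma moment_step s f : 2 <= s -> s <= q -> posbounded_mfun f -> contraction_of F f ->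
  \int[mu]_x f x `^ s <= (\int[mu]_x f x `^ (s - 1)) `^ (s / (s - 1)) +
   (s - 1) * c * (\int[mu]_x f x `^ s) `^ (1 - 2 / s).
Proof.
move=> s2 sq pf cf.
apply: le_trans (moment_inequality (resample_invariant_law hX) s2 pf) _.
rewrite lerD2l -mulrA ler_wpM2l//; first lra.
rewrite -lee_fin; apply: le_trans (sum_drop_energy_le s pf cf) _.
exact: integral_weighted_le.
Qed.

End moments_on_the_sample_space.

(** * Truncation *)

Section truncation.
Import numFieldNormedType.Exports.
Context {R : realType} {d : measure_display} {Omega : measurableType d}.
Variable P : probability Omega R.

Definition clip (N x : R) : R := Num.max (Num.min x N) (- N).

Lemma clip_id (N x : R) : `|x| <= N -> clip N x = x.
Proof. by rewrite /clip ler_norml => /andP[h1 h2]; rewrite min_l// max_l. Qed.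

Lemma clip_bounds (N x : R) : 0 <= N -> - N <= clip N x <= N.
Proof.
move=> N0; rewrite /clip le_max lexx orbT ge_max ge_min lexx orbT/=.
by rewrite (le_trans _ N0)// oppr_le0.
Qed.

Lemma clip_norm_le (N x : R) : 0 <= N -> `|clip N x| <= `|x|.
Proof.
move=> N0; have [xN|Nx] := leP `|x| N; first by rewrite clip_id.
by apply: (le_trans _ (ltW Nx)); rewrite ler_norml clip_bounds.
Qed.

Lemma subr_minl_le (N a b : R) : Num.min a N - Num.min b N <= Num.max (a - b) 0.
Proof.
rewrite le_max; apply/orP; have [ab|ab] := leP a b; [right|left];
  by case: (leP a N); case: (leP b N) => ? ?; lra.
Qed.

Lemma subr_maxl_le (N a b : R) : Num.max a N - Num.max b N <= Num.max (a - b) 0.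
Proof.
rewrite le_max; apply/orP; have [ab|ab] := leP a b; [right|left];
  by case: (leP a N); case: (leP b N) => ? ?; lra.
Qed.

Lemma max_min_sub_le (M N a b : R) :
  Num.max (Num.max (Num.min a M) N - Num.max (Num.min b M) N) 0 <= Num.max (a - b) 0.
Proof.
rewrite ge_max [in X in _ && X]le_max lexx orbT andbT.
apply: le_trans (subr_maxl_le _ _ _) _; rewrite ge_max subr_minl_le le_max lexx orbT.
by [].
Qed.

Lemma integral_clip_cvg (Z : Omega -> R) : P.-integrable setT (EFin \o Z) ->
  (\int[P]_w (clip k%:R (Z w))%:E @[k --> \oo] --> \int[P]_w (Z w)%:E)%E.
Proof.
move=> iZ; have mZ : measurable_fun setT Z.
  by apply/measurable_EFinP; exact: measurable_int iZ.
apply: (@dominated_cvg _ _ _ P setT measurableT _ _ (fun w => `|Z w|%:E)) => //.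
- move=> k; apply/measurable_EFinP.
  apply: measurable_maxr; last exact: measurable_cst.
  by apply: measurable_minr => //; exact: measurable_cst.
- move=> w _; apply: cvg_near_cst; exists (Num.truncn `|Z w|).+1 => // k /= hk.
  rewrite clip_id// (le_trans (ltW (truncnS_gt _)))//.
  by rewrite ler_nat.
- exact: (integrable_abse iZ).
- by move=> k w _ /=; rewrite lee_fin clip_norm_le.
Qed.

Lemma integral_clip_near (Z : Omega -> R) (N0 eta : R) :
  P.-integrable setT (EFin \o Z) -> 0 < eta ->
  exists2 N : R, N0 <= N & 0 <= N /\
   `|fine (\int[P]_w (Z w)%:E)%E - fine (\int[P]_w (clip N (Z w))%:E)%E| <= eta.
Proof.
move=> iZ eta0; have fZ : (\int[P]_w (Z w)%:E)%E \is a fin_num.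
  exact: (integrable_fin_num measurableT iZ).
have := integral_clip_cvg iZ; rewrite -{1}(fineK fZ) => /fine_cvg /cvgrPdist_le.
move=> /(_ _ eta0) [k _ h].
exists (maxn k (Num.truncn N0).+1)%:R.
  rewrite (le_trans (ltW (truncnS_gt _)))// ler_nat leq_maxr//.
by split; [exact: ler0n | apply: h => /=; exact: leq_maxl].
Qed.

(** Monotone convergence along min (h, k). *)
Lemma integral_powR_truncation (h : Omega -> R) (q K : R) :
  0 < q -> (forall w, 0 <= h w) -> measurable_fun setT h ->
  (forall k : nat, (\int[P]_w (Num.min (h w) k%:R `^ q)%:E <= K%:E)%E) ->
  (\int[P]_w (h w `^ q)%:E <= K%:E)%E.
Proof.
move=> q0 h0 mh hK.
have g0 w k : 0 <= Num.min (h w) k%:R :> R by rewrite le_min h0 ler0n.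
have mg k : measurable_fun setT (fun w => (Num.min (h w) k%:R `^ q)%:E).
  apply/measurable_EFinP.
  apply: (@measurableT_comp _ _ _ _ _ _ (@powR R ^~ q)) => //.
  by apply: measurable_minr => //; exact: measurable_cst.
have ndg w : {homo (fun k => (Num.min (h w) k%:R `^ q)%:E) : a b / (a <= b)%N >-> (a <= b)%E}.
  move=> a b ab; rewrite lee_fin ge0_ler_powR ?nnegrE ?(ltW q0)//.
  by rewrite le_min ge_min lexx /= ge_min ler_nat ab orbT.
have gge0 k w : [set: Omega] w -> (0 <= (Num.min (h w) k%:R `^ q)%:E)%E.
  by rewrite lee_fin powR_ge0.
have lim_g : (fun w => limn (fun k => (Num.min (h w) k%:R `^ q)%:E)) =
    (fun w => (h w `^ q)%:E).
  apply/funext => w; apply/cvg_lim => //; apply: cvg_near_cst.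
  exists (Num.truncn (h w)).+1 => // k /= hk; rewrite min_l//.
  by rewrite (le_trans (ltW (truncnS_gt _)))// ler_nat.
have := @cvg_monotone_convergence _ _ _ P setT measurableT _ mg gge0
  (fun w _ => ndg w).
rewrite lim_g => cvg_g; rewrite -(cvg_lim _ cvg_g)//.
by apply: lime_le; [exact: cvgP cvg_g | exact: nearW].
Qed.

End truncation.

(** * Moments of the truncated excess *)

Section moment_bound.
Context {R : realType} {d d' : measure_display} {Omega : measurableType d}
  {T : measurableType d'}.
Variables (P : probability Omega R) (n : nat) (X X' : 'I_n -> {mfun Omega >-> T}).
Hypothesis hX : mutually_independent P (fun i => X i : Omega -> T).
Hypothesis hX' : independent_copy P (joint X) (joint X').
Variables (F : n.-tuple T -> R) (V : Omega -> \bar R).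
Hypothesis mF : measurable_fun setT F.
Hypothesis hV : is_nonneg_cond_expectation P (sigma_of (joint X))
  (fun w => (\sum_(i < n)
     pos_part (F (joint X w) - F (joint_resample X X' i w)) ^+ 2)%:E) V.
Variables (q c : R).
Hypotheses (q2 : 2 <= q) (c0 : 0 < c).
Hypothesis Vc : (\int[P]_w (V w `^ (q / 2)) <= (c `^ (q / 2))%:E)%E.

Let mu := law_joint P X.

(** The Efron-Stein inequality for the clipped variable.  It is [moment_step]
    with s = 2, where the power of the second moment on the right has exponent
    0, applied to a translate of the clipped variable that is at least 1. *)
Lemma clip_variance (N a : R) : 0 <= N ->
  \int[mu]_x (clip N (F x) - a) ^+ 2 <= c + (\int[mu]_x clip N (F x) - a) ^+ 2.
Proof.
move=> N0; pose G x := clip N (F x) + (N + 1).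
have mclip : measurable_fun setT (fun x => clip N (F x)).
  apply: measurable_maxr; last exact: measurable_cst.
  by apply: measurable_minr => //; exact: measurable_cst.
have bclip : bounded_mfun (fun x => clip N (F x)).
  by split => //; exists N => x; rewrite ler_norml clip_bounds.
have bG : bounded_mfun G := bmfD bclip (bmf_cst (N + 1)).
have pG : posbounded_mfun G.
  split; first by case: bG.
  exists 1, (2 * N + 1); split => // x; rewrite /G.
  by have /andP[h1 h2] := clip_bounds (F x) N0; apply/andP; split; lra.
have cG : contraction_of F G.
  move=> x x'; rewrite /G opprD addrACA subrr addr0; exact: max_min_sub_le.
have G0 x : 0 <= G x by exact/ltW/(pbmf_gt0 x pG).
have := moment_step hX hX' mF hV c0 Vc (lexx _) q2 pG cG.
have -> : 2 - 1 = 1 :> R by lra.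
rewrite divr1 divff// subrr powRr0 mulr1 mul1r.
have -> : \int[mu]_x G x `^ 1 = \int[mu]_x G x.
  by apply: eq_Rintegral => x _; rewrite powRr1.
have -> : \int[mu]_x G x `^ 2 = \int[mu]_x (G x * G x).
  by apply: eq_Rintegral => x _; rewrite powR_mulrn ?expr2.
rewrite powR_mulrn; last by apply: Rintegral_ge0 => x _.
have GE : \int[mu]_x G x = \int[mu]_x clip N (F x) + (N + 1).
  rewrite (integral_bmfD _ bclip (bmf_cst _)); congr (_ + _); exact: integral_bmf_cst.
pose b := N + 1 + a.
have bGG := bmfM bG bG.
have bbG := bmfZ (2 * b) bG.
have -> : \int[mu]_x (clip N (F x) - a) ^+ 2 =
    \int[mu]_x (G x * G x) - 2 * b * \int[mu]_x G x + b ^+ 2.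
  rewrite -(integral_bmfZ _ _ bG) -(integral_bmfB _ bGG bbG).
  rewrite -[b ^+ 2](integral_bmf_cst mu) -(integral_bmfD _ (bmfB bGG bbG) (bmf_cst _)).
  by apply: eq_Rintegral => x _; rewrite /G /b; ring.
have -> : \int[mu]_x clip N (F x) - a = \int[mu]_x G x - b.
  by rewrite GE /b; ring.
by move: (\int[mu]_x G x) (\int[mu]_x (G x * G x)) => u v h; lra.
Qed.

Variable (c' : R).
Hypothesis iF : P.-integrable setT (fun w => (F (joint X w))%:E).

Let m := fine (\int[P]_w (F (joint X w))%:E)%E.

Lemma integral_clip_law (N : R) : 0 <= N ->
  \int[mu]_x clip N (F x) = fine (\int[P]_w (clip N (F (joint X w)))%:E)%E.
Proof.
move=> N0; have mclip : measurable_fun setT (fun x => clip N (F x)).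
  apply: measurable_maxr; last exact: measurable_cst.
  by apply: measurable_minr => //; exact: measurable_cst.
have bclip : bounded_mfun (fun x => clip N (F x)).
  by split => //; exists N => x; rewrite ler_norml clip_bounds.
have := @integral_pushforward _ _ _ _ _ _ (measurable_joint X) P setT
  (fun x => (clip N (F x))%:E).
rewrite preimage_setT /Rintegral => <- //.
- by apply/measurable_EFinP.
- apply: (@bmf_integrable _ _ _ P (fun w => clip N (F (joint X w)))).
  split; first exact: (measurableT_comp mclip (measurable_joint X)).
  by have [_ [B hB]] := bclip; exists B => w.
Qed.

(** The lower level eps keeps the excess positive; the upper level M bounds
    it. *)
Definition trunc_excess (eps M : R) (x : n.-tuple T) : R :=
  Num.max (Num.min (F x - m) M) eps.

Lemma pbmf_trunc_excess eps M : 0 < eps -> posbounded_mfun (trunc_excess eps M).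
Proof.
move=> e0; split.
  apply: measurable_maxr; last exact: measurable_cst.
  apply: measurable_minr; last exact: measurable_cst.
  by apply: measurable_funB => //; exact: measurable_cst.
exists eps, (Num.max M eps); split => // x; rewrite /trunc_excess.
apply/andP; split; first by rewrite le_max lexx orbT.
rewrite ge_max; apply/andP; split; rewrite le_max; apply/orP; [left|right] => //.
by rewrite ge_min lexx orbT.
Qed.

Lemma contraction_trunc_excess eps M : contraction_of F (trunc_excess eps M).
Proof.
move=> x x'; have -> : F x - F x' = (F x - m) - (F x' - m) by ring.
exact: max_min_sub_le.
Qed.

(** Once the clipping level exceeds |M| + |E Z|, the squared truncated excess is
    at most eps^2 plus the squared distance of the clipped variable to E Z.
    The room c' - c pays for eps^2 twice: once for the lower truncation, once
    for the distance between E Z and the mean of the clipped variable. *)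
Lemma trunc_excess_second_moment eps M : 0 < eps -> eps ^+ 2 <= (c' - c) / 2 ->
  \int[mu]_x trunc_excess eps M x `^ 2 <= c'.
Proof.
move=> e0 e2; have pf := pbmf_trunc_excess M e0.
have [N NM [N0 near]] := integral_clip_near (`|M| + `|m|) iF e0.
rewrite -/m -integral_clip_law// in near.
have mclip : measurable_fun setT (fun x => clip N (F x)).
  apply: measurable_maxr; last exact: measurable_cst.
  by apply: measurable_minr => //; exact: measurable_cst.
have bclip : bounded_mfun (fun x => clip N (F x)).
  by split => //; exists N => x; rewrite ler_norml clip_bounds.
have bcm := bmfB bclip (bmf_cst m).
have bcm2 := bmfM bcm bcm.
have pw x : trunc_excess eps M x `^ 2 <= eps ^+ 2 + (clip N (F x) - m) ^+ 2.
  have t0 := pbmf_gt0 x pf.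
  rewrite powR_mulrn ?(ltW t0)// /trunc_excess.
  have [h|h] := leP (Num.min (F x - m) M) eps; first by rewrite lerDl sqr_ge0.
  have le1 : Num.min (F x - m) M <= clip N (F x) - m.
    have M1 := ler_norm M; have m1 := ler_norm m.
    have m2 : - m <= `|m| by rewrite -normrN ler_norm.
    rewrite /clip lerBrDr le_max; apply/orP; left.
    rewrite le_min; apply/andP; split.
      by rewrite -lerBrDr ge_min lexx.
    by rewrite -lerBrDr ge_min; apply/orP; right; lra.
  apply: (@le_trans _ _ ((clip N (F x) - m) ^+ 2)); last by rewrite lerDr sqr_ge0.
  rewrite lerXn2r// nnegrE; first exact: (le_trans (ltW e0) (ltW h)).
  exact: (le_trans (ltW e0) (le_trans (ltW h) le1)).
apply: (@le_trans _ _ (\int[mu]_x (eps ^+ 2 + (clip N (F x) - m) ^+ 2))).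
  apply: le_integral_bmf => //; first exact/pbmf_bmf/pbmf_powR.
  exact: (bmfD (bmf_cst _) bcm2).
rewrite (integral_bmfD _ (bmf_cst _) bcm2) integral_bmf_cst.
have := clip_variance m N0.
have h2 : (\int[mu]_x clip N (F x) - m) ^+ 2 <= eps ^+ 2.
  by rewrite -[leLHS]real_normK ?num_real// distrC lerXn2r ?nnegrE ?(ltW e0).
move: near h2; move: (\int[mu]_x (clip N (F x) - m) ^+ 2) => u _.
by move: (_ ^+ 2) => v h2 h3; lra.
Qed.

(** Each step feeds a bound U on the squared norm of order t - 1 into
    [moment_recursion].  From s - 1 to s, U is the bound already obtained, and
    kappa_{s-1} <= kappa_s together with s - 2 <= (1 - 1/s) (s - 1) lets the
    recursion apply.  For s < 3 the order s - 1 is at most 2, and U = c by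
    concavity of x^{(s-1)/2}. *)
Lemma moment_induction f (k : nat) s : posbounded_mfun f -> contraction_of F f ->
  \int[mu]_x f x `^ 2 <= c -> 2 <= s -> s <= q -> s < k%:R + 3 ->
  \int[mu]_x f x `^ s <= (2 * kappa_ s * (s - 1) * c) `^ (s / 2).
Proof.
move=> pf cf f2.
have intP_ge0 t : 0 <= \int[mu]_x f x `^ t.
  by apply: Rintegral_ge0 => x _; exact: powR_ge0.
have step t U : 2 <= t -> t <= q -> 0 <= U ->
    U <= (1 - t^-1) * (2 * kappa_ t * (t - 1) * c) ->
    \int[mu]_x f x `^ (t - 1) <= U `^ ((t - 1) / 2) ->
    \int[mu]_x f x `^ t <= (2 * kappa_ t * (t - 1) * c) `^ (t / 2).
  move=> t2 tq U0 UK fU; apply: (moment_recursion t2 c0 U0 (intP_ge0 t) UK).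
  apply: le_trans (moment_step hX hX' mF hV c0 Vc t2 tq pf cf) _.
  have t0 : 0 < t by lra.
  have t10 : 0 < t - 1 by lra.
  rewrite lerD2r (_ : t / 2 = (t - 1) / 2 * (t / (t - 1))); last first.
    by field; rewrite gt_eqF.
  by rewrite [leRHS]powRrM ge0_ler_powR ?nnegrE ?powR_ge0// divr_ge0// ltW.
have base t : 2 <= t -> t <= q -> t < 3 ->
    \int[mu]_x f x `^ t <= (2 * kappa_ t * (t - 1) * c) `^ (t / 2).
  move=> t2 tq t3; have t0 : 0 < t by lra.
  apply: (step _ c t2 tq (ltW c0)).
    have k1 := kappa_ge1 t2.
    have -> : (1 - t^-1) * (2 * kappa_ t * (t - 1) * c) =
      ((1 - t^-1) * 2) * kappa_ t * (t - 1) * c by ring.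
    have it : t^-1 <= 2^-1 by rewrite lef_pV2 ?posrE.
    have h1 : 1 <= (1 - t^-1) * 2 by lra.
    have h2 : 1 <= (1 - t^-1) * 2 * kappa_ t by apply: mulr_ege1.
    have h3 : 1 <= (1 - t^-1) * 2 * kappa_ t * (t - 1).
      by apply: mulr_ege1 => //; lra.
    by rewrite ler_peMl// ltW.
  have bf2 := pbmf_bmf (pbmf_powR 2 pf).
  pose e := (t - 1) / 2.
  have e0 : 0 <= e by rewrite /e divr_ge0//; lra.
  have e1 : e <= 1 by rewrite /e ler_pdivrMr//; lra.
  have ce0 : 0 < c `^ e by rewrite powR_gt0.
  have bd := bmfD (bmf_cst (1 - e)) (bmfZ (e / c) bf2).
  apply: (@le_trans _ _ (\int[mu]_x (c `^ e * (1 - e + e / c * f x `^ 2)))).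
    apply: le_integral_bmf.
    - exact/pbmf_bmf/pbmf_powR.
    - exact: bmfZ.
    move=> x; have := powR_concave1 e0 e1 (divr_ge0 (powR_ge0 (f x) 2) (ltW c0)).
    rewrite -(ler_pM2l ce0) -powRM ?divr_ge0 ?powR_ge0 ?(ltW c0)//.
    rewrite mulrCA divff ?gt_eqF// mulr1 -powRrM (_ : 2 * e = t - 1); last first.
      by rewrite /e; field.
    by move=> /le_trans; apply; rewrite mulrA mulrAC -mulrA lexx.
  rewrite (integral_bmfZ _ _ bd) (integral_bmfD _ (bmf_cst _) (bmfZ _ bf2)).
  rewrite (integral_bmfZ _ _ bf2) integral_bmf_cst -/e.
  rewrite -[leRHS]mulr1 ler_pM2l//.
  have h : e / c * \int[mu]_x f x `^ 2 <= e / c * c.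
    by rewrite ler_wpM2l// divr_ge0// ltW.
  by rewrite divfK ?gt_eqF// in h; lra.
elim: k s => [|k IH] s s2 sq sk; first by apply: base => //; lra.
have [s3|s3] := ltP s 3; first exact: base.
have s12 : 2 <= s - 1 by lra.
have s1k : s - 1 < k%:R + 3 by rewrite -natr1 in sk; lra.
have k1 := kappa_ge1 s12.
have kk : kappa_ (s - 1) <= kappa_ s by apply: kappa_incr => //; lra.
have is0 : 0 < s^-1 by rewrite invr_gt0; lra.
have is1 : s^-1 <= 1 by rewrite invf_le1; lra.
apply: (step s (2 * kappa_ (s - 1) * (s - 1 - 1) * c)) => //.
- apply: mulr_ge0 (ltW c0); apply: mulr_ge0; last lra.
  by apply: mulr_ge0 => //; lra.
- have -> : (1 - s^-1) * (2 * kappa_ s * (s - 1) * c) =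
    2 * kappa_ s * ((1 - s^-1) * (s - 1)) * c by ring.
  rewrite ler_pM2r//.
  apply: ler_pM; [lra | lra | lra |].
  have -> : (1 - s^-1) * (s - 1) = s - 2 + s^-1.
    by field; rewrite gt_eqF//; lra.
  lra.
by apply: IH => //; lra.
Qed.

End moment_bound.

(** * Removing the truncation *)

Lemma Lnorm_EFin {R : realType} {d : measure_display} {Omega : measurableType d}
    (m : {measure set Omega -> \bar R}) (p : R) (f : Omega -> R) :
  (forall w, 0 <= f w) ->
  ('N[m]_(p%:E) [(fun w => (f w)%:E)] = (\int[m]_w (f w `^ p)%:E) `^ p^-1)%E.
Proof.
move=> f0; rewrite unlock.
suff -> : (\int[m]_w (`|(f w)%:E| `^ p) = \int[m]_w (f w `^ p)%:E)%E by [].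
apply: eq_integral => w _.
by rewrite /= ger0_norm.
Qed.

Section upper_moment.
Context {R : realType} {d d' : measure_display} {Omega : measurableType d}
  {T : measurableType d'}.
Variables (P : probability Omega R) (n : nat) (X X' : 'I_n -> {mfun Omega >-> T}).
Hypothesis hX : mutually_independent P (fun i => X i : Omega -> T).
Hypothesis hX' : independent_copy P (joint X) (joint X').
Variables (F : n.-tuple T -> R) (V : Omega -> \bar R).
Hypothesis mF : measurable_fun setT F.
Hypothesis iF : P.-integrable setT (fun w => (F (joint X w))%:E).
Hypothesis hV : is_nonneg_cond_expectation P (sigma_of (joint X))
  (fun w => (\sum_(i < n)
     pos_part (F (joint X w) - F (joint_resample X X' i w)) ^+ 2)%:E) V.
Variable q : R.
Hypothesis q2 : 2 <= q.

Let m := fine (\int[P]_w (F (joint X w))%:E)%E.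

(** The gap between c and c' absorbs the error made by truncating from below
    at eps, which is chosen with eps^2 <= (c' - c) / 2; the truncation from
    above is removed by monotone convergence. *)
Lemma upper_moment_le (c c' : R) : 0 < c -> c < c' ->
  (\int[P]_w (V w `^ (q / 2)) <= (c `^ (q / 2))%:E)%E ->
  (\int[P]_w (pos_part (F (joint X w) - m) `^ q)%:E
    <= ((2 * kappa_ q * (q - 1) * c') `^ (q / 2))%:E)%E.
Proof.
move=> c0 cc' Vc; have c'0 : 0 < c' by exact: lt_trans cc'.
have q0 : 0 < q by exact: lt_le_trans q2.
have Vc' : (\int[P]_w (V w `^ (q / 2)) <= (c' `^ (q / 2))%:E)%E.
  apply: le_trans Vc _; rewrite lee_fin ge0_ler_powR ?nnegrE ?(ltW c0) ?(ltW c'0) ?(ltW cc')//.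
  by rewrite divr_ge0// ltW.
pose del : R := (c' - c) / 2.
have del0 : 0 < del by rewrite divr_gt0// subr_gt0.
pose eps := Num.min 1 del.
have e0 : 0 < eps by rewrite lt_min ltr01.
have e2 : eps ^+ 2 <= del.
  rewrite expr2; apply: (@le_trans _ _ (1 * eps)).
    by rewrite ler_pM2r// ge_min lexx.
  by rewrite mul1r ge_min lexx orbT.
have mpos : measurable_fun setT (fun w => pos_part (F (joint X w) - m)).
  apply: measurable_maxr; last exact: measurable_cst.
  apply: measurable_funB; last exact: measurable_cst.
  exact: (measurableT_comp mF (measurable_joint X)).
apply: integral_powR_truncation => //.
  by move=> w; rewrite le_max lexx orbT.
move=> k; pose f := trunc_excess P X F eps k%:R.
have pf : posbounded_mfun f by exact: pbmf_trunc_excess.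
have bfq := pbmf_bmf (pbmf_powR q pf).
have cf : contraction_of F f by exact: contraction_trunc_excess.
have f2 := trunc_excess_second_moment hX hX' mF hV q2 c0 Vc iF k%:R e0 e2.
have [N _ qN] : exists2 N : nat, True & q < N%:R + 3.
  exists (Num.truncn q).+1 => //.
  by apply: lt_trans (truncnS_gt q) _; rewrite ltrDl.
have := moment_induction hX hX' mF hV c'0 Vc' pf cf f2 q2 (lexx _) qN.
rewrite -lee_fin -(bmf_integralE _ bfq) => h; apply: le_trans h.
rewrite integral_law_joint; last 2 first.
- by apply/measurable_EFinP; case: bfq.
- by move=> x; rewrite lee_fin powR_ge0.
apply: ge0_le_integral => //.
- by move=> w _; rewrite lee_fin powR_ge0.
- apply/measurable_EFinP; apply: (@measurableT_comp _ _ _ _ _ _ (@powR R ^~ q)) => //.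
  by apply: measurable_minr => //; exact: measurable_cst.
- apply/measurable_EFinP; case: bfq => mfq _.
  exact: (measurableT_comp mfq (measurable_joint X)).
move=> w _; rewrite lee_fin.
have min0 : 0 <= Num.min (pos_part (F (joint X w) - m)) k%:R.
  by rewrite le_min le_max lexx orbT/= ler0n.
apply: ge0_ler_powR; rewrite ?nnegrE ?(ltW q0) ?(ltW (pbmf_gt0 _ pf))//.
rewrite /f /trunc_excess -/m /pos_part.
move: (F _ - m) => y; have [y0|y0] := leP y 0.
  apply: (@le_trans _ _ 0); first by rewrite ge_min lexx.
  by rewrite le_max (ltW e0) orbT.
by rewrite le_max lexx.
Qed.

(** If the norm of V is infinite there is nothing to prove.  Otherwise
    [upper_moment_le] applies with every c larger than that norm, and c is let
    down to it. *)
Lemma upper_moment_Lnorm :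
  ('N[P]_(q%:E) [(fun w => (pos_part (F (joint X w) - m))%:E)]
     <= sqrte (((1 - q^-1) * (2 * kappa_ q) * q)%:E * 'N[P]_((q / 2)%:E) [V]))%E.
Proof.
have q0 : 0 < q by exact: lt_le_trans q2.
have qn0 : q != 0 by rewrite gt_eqF.
have h0 : 0 < q / 2 by rewrite divr_gt0.
have CE : (1 - q^-1) * (2 * kappa_ q) * q = 2 * kappa_ q * (q - 1).
  by move: (kappa_ q) => k; field.
have C0 : 0 < 2 * kappa_ q * (q - 1).
  have k1 := kappa_ge1 q2.
  have k0 : 0 < kappa_ q by exact: lt_le_trans k1.
  have q10 : 0 < q - 1 by have := q2; lra.
  by apply: mulr_gt0 q10; exact: mulr_gt0.
rewrite CE; move: (2 * kappa_ q * (q - 1)) C0 upper_moment_le => C C0 bound.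
have [V0 _ _] := hV.
have N0 : (0 <= 'N[P]_((q / 2)%:E) [V])%E by exact: Lnorm_ge0.
have VE : (\int[P]_w (V w `^ (q / 2)) = 'N[P]_((q / 2)%:E) [V] `^ (q / 2))%E.
  rewrite poweR_Lnorm ?gt_eqF//; apply: eq_integral => w _.
  by rewrite gee0_abs.
move: ('N[P]_((q / 2)%:E) [V])%E N0 VE => N; case: N => [c N0 VE|_ _|//]; last first.
  by rewrite gt0_muley ?lte_fin//= leey.
rewrite lee_fin in N0; rewrite poweR_EFin in VE.
set I := (\int[P]_w (pos_part (F (joint X w) - m) `^ q)%:E)%E.
rewrite Lnorm_EFin; last by move=> w; rewrite le_max lexx orbT.
rewrite -/I.
have I0 : (0 <= I)%E by apply: integral_ge0 => w _; rewrite lee_fin powR_ge0.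
have bd del : 0 < del -> (I <= ((C * (c + del)) `^ (q / 2))%:E)%E.
  move=> del0; apply: (bound (c + del / 2) (c + del)).
  - by rewrite ltr_wpDl// divr_gt0.
  - by rewrite ltrD2l ltr_pdivrMr// mulr_natr mulr2n ltrDl.
  rewrite VE lee_fin ge0_ler_powR ?nnegrE ?(ltW h0)// ?lerDl ?addr_ge0 ?divr_ge0//; exact: ltW.
have If : I \is a fin_num.
  by rewrite ge0_fin_numE// (le_lt_trans (bd _ ltr01))// ltry.
rewrite -(fineK If) poweR_EFin -EFinM /= lee_fin.
have i0 : 0 <= fine I by exact: fine_ge0.
set x := fine I `^ q^-1.
have x2 : x ^+ 2 <= C * c.
  apply/ler_addgt0Pr => e e0.
  have := bd _ (divr_gt0 e0 C0).
  rewrite -{1}(fineK If) lee_fin mulrDr mulrCA divff ?gt_eqF// mulr1 => h.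
  have Ce0 : 0 <= C * c + e by rewrite addr_ge0 ?mulr_ge0// ltW.
  have xE : x ^+ 2 = fine I `^ (q^-1 * 2%:R).
    by rewrite powRrM powR_mulrn// powR_ge0.
  have -> : C * c + e = ((C * c + e) `^ (q / 2)) `^ (q^-1 * 2%:R).
    by rewrite -powRrM (_ : q / 2 * (q^-1 * 2%:R) = 1) ?powRr1//; field; rewrite gt_eqF.
  rewrite xE ge0_ler_powR ?nnegrE ?powR_ge0//.
  by rewrite mulr_ge0 ?invr_ge0 ?(ltW q0).
have x0 : 0 <= x by exact: powR_ge0.
rewrite -(ger0_norm x0) -sqrtr_sqr ler_sqrt//.
by rewrite mulr_ge0// ltW.
Qed.

End upper_moment.

Section constants.
Context {R : realType} {d : measure_display} {Omega : measurableType d}.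
Variables (P : probability Omega R) (V : Omega -> \bar R) (q : R).
Hypotheses (q2 : 2 <= q) (V0 : forall w, (0 <= V w)%E).

Lemma kappa_Lnorm_le :
  (sqrte (((1 - q^-1) * (2 * kappa_ q) * q)%:E * 'N[P]_((q / 2)%:E) [V])
     <= sqrte ((2 * kappa * q)%:E * 'N[P]_((q / 2)%:E) [V]))%E.
Proof.
have k1 := kappa_ge1 q2; have kk := kappa_le_kappa q2.
have q0 : 0 < q by exact: lt_le_trans q2.
have ka0 : 0 <= kappa :> R by exact: le_trans (le_trans ler01 k1) kk.
rewrite lee_sqrt; last first.
  apply: mule_ge0; last exact: Lnorm_ge0.
  by rewrite lee_fin; apply: mulr_ge0 (ltW q0); exact: mulr_ge0.
apply: lee_wpmul2r; first exact: Lnorm_ge0.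
rewrite lee_fin ler_pM2r//.
have i0 : 0 < q^-1 by rewrite invr_gt0.
have i1 : q^-1 <= 1 by rewrite invf_le1//; have := q2; lra.
apply: (@le_trans _ _ (1 * (2 * kappa_ q))).
  apply: ler_wpM2r; last by have := i0; lra.
  by apply: mulr_ge0 => //; apply: le_trans k1.
by rewrite mul1r ler_pM2l.
Qed.

(** Both norms are powers of the mean of V^{q/2}. *)
Lemma sqrte_Lnorm_half (a : R) : 0 <= a ->
  (sqrte (a%:E * 'N[P]_((q / 2)%:E) [V])
    = (Num.sqrt a)%:E * 'N[P]_(q%:E) [(fun w => sqrte (V w))])%E.
Proof.
move=> a0; have q0 : 0 < q by exact: lt_le_trans q2.
rewrite sqrteM ?lee_fin//; congr (_ * _)%E.
rewrite -poweR12_sqrt ?Lnorm_ge0// unlock -poweRrM.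
have -> : (q / 2)^-1 / 2 = q^-1 by field; rewrite gt_eqF.
congr (_ `^ _)%E; apply: eq_integral => w _.
rewrite !gee0_abs ?sqrte_ge0// -poweR12_sqrt// -poweRrM.
by rewrite mulrC.
Qed.

End constants.

(** * Moments of the positive and negative parts *)

Theorem theorem2 (R : realType) (d d' : measure_display)
    (Omega : measurableType d) (T : measurableType d')
    (P : probability Omega R) (n : nat)
    (X X' : 'I_n -> {RV P >-> T})
    (F : n.-tuple T -> R) (Z : Omega -> R) (Z' : 'I_n -> Omega -> R)
    (Vp Vm : Omega -> \bar R)
    (hX : mutually_independent P (fun i => X i : Omega -> T))
    (hX' : independent_copy P (joint X) (joint X'))
    (hF : measurable_fun [set: n.-tuple T] F)
    (hZ : Z = (fun w => F (joint X w)))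
    (hZ' : Z' = (fun i w => F (joint_resample X X' i w)))
    (hint : P.-integrable [set: Omega] (EFin \o Z))
    (hVp : is_nonneg_cond_expectation P (sigma_of (joint X))
       (fun w => (\sum_(i < n) pos_part (Z w - Z' i w) ^+ 2)%:E) Vp)
    (hVm : is_nonneg_cond_expectation P (sigma_of (joint X))
       (fun w => (\sum_(i < n) neg_part (Z w - Z' i w) ^+ 2)%:E) Vm)
    (q : R) (hq : 2 <= q) :
  [/\ ('N[P]_(q%:E) [(fun w => (pos_part (Z w - fine ('E_P[Z])))%:E)]
         <= sqrte (((1 - q^-1) * (2 * kappa_ q) * q)%:E
                   * 'N[P]_((q / 2)%:E) [Vp]))%E,
      (sqrte (((1 - q^-1) * (2 * kappa_ q) * q)%:E
              * 'N[P]_((q / 2)%:E) [Vp])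
         <= sqrte ((2 * kappa * q)%:E * 'N[P]_((q / 2)%:E) [Vp]))%E &
      sqrte ((2 * kappa * q)%:E * 'N[P]_((q / 2)%:E) [Vp])%E
        = ((Num.sqrt (2 * kappa * q))%:E
           * 'N[P]_(q%:E) [(fun w => sqrte (Vp w))])%E]
  /\
  [/\ ('N[P]_(q%:E) [(fun w => (neg_part (Z w - fine ('E_P[Z])))%:E)]
         <= sqrte (((1 - q^-1) * (2 * kappa_ q) * q)%:E
                   * 'N[P]_((q / 2)%:E) [Vm]))%E,
      (sqrte (((1 - q^-1) * (2 * kappa_ q) * q)%:E
              * 'N[P]_((q / 2)%:E) [Vm])
         <= sqrte ((2 * kappa * q)%:E * 'N[P]_((q / 2)%:E) [Vm]))%E &
      sqrte ((2 * kappa * q)%:E * 'N[P]_((q / 2)%:E) [Vm])%E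
        = ((Num.sqrt (2 * kappa * q))%:E
           * 'N[P]_(q%:E) [(fun w => sqrte (Vm w))])%E].
Proof.
have c0 : 0 <= 2 * kappa * q.
  have k0 : 0 <= kappa :> R.
    exact: le_trans (le_trans ler01 (kappa_ge1 hq)) (kappa_le_kappa hq).
  have q0 : 0 <= q by exact: le_trans hq.
  by apply: mulr_ge0 q0; exact: mulr_ge0.
have [Vp0 _ _] := hVp; have [Vm0 _ _] := hVm.
subst Z Z'.
have mE : fine ('E_P[fun w => F (joint X w)])%E
  = fine (\int[P]_w (F (joint X w))%:E)%E by rewrite unlock.
rewrite mE; split; split.
- exact: (upper_moment_Lnorm hX hX' hF hint hVp hq).
- exact: kappa_Lnorm_le.
- exact: sqrte_Lnorm_half.
- have hNF : measurable_fun setT (fun x => - F x) by exact: measurableT_comp.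
  have hNint : P.-integrable setT (fun w => (- F (joint X w))%:E).
    exact: (@integrableN _ _ _ _ _ _ hint).
  have negE x y : pos_part (- x - - y) = neg_part (x - y) :> R.
    by rewrite /pos_part /neg_part opprB opprK addrC.
  have hVN : is_nonneg_cond_expectation P (sigma_of (joint X)) (fun w =>
     (\sum_(i < n) pos_part (- F (joint X w) - - F (joint_resample X X' i w)) ^+ 2)%:E) Vm.
    have [V0 mV VY] := hVm; split => // A GA; rewrite VY//.
    apply: eq_integral => w _; congr EFin.
    by apply: eq_bigr => i _; rewrite negE.
  have := upper_moment_Lnorm hX hX' hNF hNint hVN hq.
  have -> : fine (\int[P]_w (- F (joint X w))%:E)%E
      = - fine (\int[P]_w (F (joint X w))%:E)%E.
    rewrite -fineN; congr fine; rewrite -integralN//.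
    exact/integrable_add_def.
  set N1 := Lnorm _ _ _; set N2 := Lnorm _ _ (fun w => (neg_part _)%:E).
  suff -> : N1 = N2 by [].
  by apply: eq_Lnorm => w; rewrite negE.
- exact: kappa_Lnorm_le.
- exact: sqrte_Lnorm_half.
Qed.
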